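(* Let $G$ be a finite group. The following are equivalent. (i) $G$ is purely non-abelian. (ii) Every $\psi\in\mathrm{Aut}(\mathcal{D}(G))$, with components $(p,u,r,v)$, has $u$ and $v$ isomorphisms. (iii) For every $r'\in\mathrm{Hom}(G,\widehat{G})$ and every automorphism $(p,u,r,v)\in\mathrm{Aut}(\mathcal{D}(G))$, also $(p,u,r',v)\in\mathrm{Aut}(\mathcal{D}(G))$. (iv) $\mathrm{Aut}(\mathcal{D}(G))=\Lambda(G)\,K$ is an exact factorization, where $K=\mathrm{SpAut}_c(G)\ltimes\mathrm{Hom}(G,\widehat{G})$.
   Context: The base field $\mathbbm{k}$ is algebraically closed of characteristic zero. For a finite group $G$, $\mathbbm{k}^G$ is the linear dual of $\mathbbm{k}G$, with dual basis $\{e_g\}_{g\in G}$ and identity $\varepsilon=\sum_{g}e_g$; $\widehat{G}=\mathrm{Hom}(G,\mathbbm{k}^\times)$ is the group of group-like elements of $\mathbbm{k}^G$. The Drinfeld double $\mathcal{D}(G)$ is the Hopf algebra with basis $e_g\# h$ ($g,h\in G$), multiplication $(e_g\# g')(e_h\# h')=\delta_{g,\,g'hg'^{-1}}\,e_g\# g'h'$, unit $\varepsilon\# 1$, and coalgebra structure $(\mathbbm{k}^G)^{\mathrm{cop}}\otimes\mathbbm{k}G$. $\mathrm{Aut}(\mathcal{D}(G))$ is its group of Hopf algebra automorphisms. Every Hopf algebra endomorphism $\psi$ of $\mathcal{D}(G)$ is determined by, and identified with, its components $(p,u,r,v)$, where $u(a)=(\mathrm{id}\otimes\varepsilon)\psi(a\#1)\in\mathbbm{k}^G$,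 $p(a)=(\mathrm{ev}_1\otimes\mathrm{id})\psi(a\#1)\in\mathbbm{k}G$, $r(g)=(\mathrm{id}\otimes\varepsilon)\psi(\varepsilon\# g)\in\widehat{G}$, $v(g)=(\mathrm{ev}_1\otimes\mathrm{id})\psi(\varepsilon\# g)\in G$ for $a\in\mathbbm{k}^G$, $g\in G$ (here $\mathrm{ev}_1(f)=f(1)$ and $\varepsilon$ in the second tensor factor is the counit of $\mathbbm{k}G$); one has $\psi(a\# g)=u(a_{(1)})r(g)\# p(a_{(2)})v(g)$, with Sweedler notation in $(\mathbbm{k}^G)^{\mathrm{cop}}$. Writing $(p,u,r',v)\in\mathrm{Aut}(\mathcal{D}(G))$ means that the linear map $a\# g\mapsto u(a_{(1)})r'(g)\# p(a_{(2)})v(g)$ is a Hopf algebra automorphism. Trivial $p$ means $p(a)=a(1)1_G$; trivial $r$ means $r(g)=\varepsilon$ for all $g$. $\Lambda(G)$ is the subgroup of automorphisms with $u=\mathrm{id}$, $v=\mathrm{id}$ and $r$ trivial. $K$ is the subgroup of all automorphisms with $p$ trivial; it is the semidirect product of the subgroup $\mathrm{SpAut}_c(G)$, consisting of the maps $e_g\# h\mapsto e_{w(g)}\# v(h)$ with $w,v\in\mathrm{Aut}(G)$ and $w^{-1}v$ a central automorphism of $G$ (i.e. $w^{-1}v(g)g^{-1}\in Z(G)$ for all $g$), and the normal subgroup $\mathrm{Hom}(G,\widehat{G})$, consisting of the maps $e_g\# h\mapsto r(h)e_g\# h$. A group is purely non-abelian if it has no non-trivial abelian direct factor. An exact factorization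 of a group $X$ is a pair of subgroups $Y,Z$ with $X=YZ$ and $Y\cap Z=1$. *)

(* Defs.v *)
From HB Require Import structures.
From mathcomp Require Import all_boot all_order all_algebra all_fingroup.
From mathcomp Require Import all_solvable all_field ring.

Set Implicit Arguments.
Unset Strict Implicit.
Unset Printing Implicit Defensive.

Import GRing.Theory.
Local Open Scope ring_scope.

(* Tensor products are taken in coordinates: k^I (x) k^J is k^(I * J). *)

Section BasedSpaces.
Variable k : fieldType.

Definition delta (I : finType) (i : I) : {ffun I -> k^o} :=
  [ffun j => (j == i)%:R].

Definition tens (I J : finType) (a : {ffun I -> k^o}) (b : {ffun J -> k^o}) :
  {ffun I * J -> k^o} := [ffun p => a p.1 * b p.2].

Definition slice (I J : finType) (t : {ffun I * J -> k^o}) (i : I) :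
  {ffun J -> k^o} := [ffun j => t (i, j)].

Lemma sum_dlt (I : finType) (c : I) (F : I -> k) :
  \sum_i (i == c)%:R * F i = F c.
Proof.
rewrite (bigD1 c) //= eqxx mul1r big1 ?addr0 // => i /negPf->.
by rewrite mul0r.
Qed.

Lemma sum_dltr (I : finType) (c : I) (F : I -> k) :
  \sum_i F i * (i == c)%:R = F c.
Proof. by under eq_bigr do rewrite mulrC; exact: sum_dlt. Qed.

Lemma sum_dlt' (I : finType) (c : I) (F : I -> k) :
  \sum_i (c == i)%:R * F i = F c.
Proof. by under eq_bigr do rewrite eq_sym; exact: sum_dlt. Qed.

Lemma sum_dltr' (I : finType) (c : I) (F : I -> k) :
  \sum_i F i * (c == i)%:R = F c.
Proof. by under eq_bigr do rewrite eq_sym; exact: sum_dltr. Qed.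

Lemma delta_sum (I : finType) (x : {ffun I -> k^o}) :
  x = \sum_i x i *: delta i.
Proof.
apply/ffunP=> j; rewrite sum_ffunE -[LHS](sum_dltr j x).
by apply: eq_bigr => i _; rewrite !ffunE eq_sym.
Qed.

End BasedSpaces.

(* Finite-dimensional Hopf algebras over k, with a chosen basis hbasis and its
   coordinate map hcoord. *)

HB.mixin Record isHopfAlgebra (k : fieldType) A of Falgebra k A := {
  hidx : finType;
  hbasis : hidx -> A;
  hcoord : A -> {ffun hidx -> k^o};
  hcoord_linear : linear hcoord;
  hbasisK : forall i, hcoord (hbasis i) = delta k i;
  hcoordK : forall x, x = \sum_i hcoord x i *: hbasis i;
  comul : A -> {ffun hidx * hidx -> k^o};
  comul_linear : linear comul;
  comulA : forall x i j l,
    \sum_m comul x (m, l) * comul (hbasis m) (i, j)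
    = \sum_m comul x (i, m) * comul (hbasis m) (j, l);
  comul1 : comul 1 = tens (hcoord 1) (hcoord 1);
  comulM : forall x y,
    comul (x * y) = \sum_p \sum_q (comul x p * comul y q) *:
      tens (hcoord (hbasis p.1 * hbasis q.1))
           (hcoord (hbasis p.2 * hbasis q.2));
  counit : A -> k^o;
  counit_linear : linear counit;
  counit1 : counit 1 = 1;
  counitM : {morph counit : x y / x * y};
  comul_counitl : forall x,
    \sum_p (comul x p * counit (hbasis p.1)) *: hbasis p.2 = x;
  comul_counitr : forall x,
    \sum_p (comul x p * counit (hbasis p.2)) *: hbasis p.1 = x;
  antipode : A -> A;
  antipode_linear : linear antipode;
  antipodel : forall x,
    \sum_p comul x p *: (antipode (hbasis p.1) * hbasis p.2) = (counit x)%:A;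
  antipoder : forall x,
    \sum_p comul x p *: (hbasis p.1 * antipode (hbasis p.2)) = (counit x)%:A
}.

#[short(type="hopfAlgType")]
HB.structure Definition HopfAlgebra (k : fieldType) :=
  { A of Falgebra k A & isHopfAlgebra k A }.

Section HopfMorphisms.
Variables (k : fieldType).

Definition tensor_map (A B : hopfAlgType k) (f : A -> B)
    (t : {ffun @hidx k A * @hidx k A -> k^o}) : {ffun @hidx k B * @hidx k B -> k^o} :=
  \sum_p t p *: tens (hcoord (f (hbasis p.1))) (hcoord (f (hbasis p.2))).

Record hopf_morphism (A B : hopfAlgType k) (f : A -> B) : Prop := {
  hopf_linear : linear f;
  hopf_1 : f 1 = 1;
  hopf_M : {morph f : x y / x * y};
  hopf_comul : forall x, comul (f x) = tensor_map f (comul x);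
  hopf_counit : forall x, counit (f x) = counit x;
  hopf_antipode : forall x, f (antipode x) = antipode (f x)
}.

Definition hopf_aut (A : hopfAlgType k) (f : A -> A) : Prop :=
  hopf_morphism f /\ bijective f.

End HopfMorphisms.

Lemma sum_pairE (V : nmodType) (I J : finType) (F : I * J -> V) :
  \sum_p F p = \sum_i \sum_j F (i, j).
Proof. by rewrite pair_bigA; apply: eq_bigr => -[]. Qed.

Lemma tens_sumE (k : fieldType) (I : finType) (M : I -> I -> I -> k)
    (al : I -> I -> k) (be : I -> I -> I) (X Y : I * I -> k) a b :
    (forall p q r, M p q r = al p r * (q == be p r)%:R) ->
  \sum_p \sum_q (X p * Y q) * (M p.1 q.1 a * M p.2 q.2 b) =
  \sum_i \sum_j X (i, j) * (al i a * al j b) * Y (be i a, be j b).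
Proof.
move=> ME; rewrite [RHS]pair_bigA; apply: eq_bigr => -[i j] _ /=.
rewrite -[RHS](sum_dltr (be i a, be j b) (fun q => X (i, j) * (al i a * al j b) * Y q)).
apply: eq_bigr => -[q1 q2] _; rewrite !ME /= xpair_eqE -mulnb natrM.
by rewrite -!mulrA; congr (_ * _); rewrite !(mulrCA (Y _)); congr (_ * _); rewrite mulrCA.
Qed.

Section FunAlgebra.
Variables (k : fieldType) (gT : finGroupType).

(* k^G; the library's pointwise ring structure on {ffun gT -> k^o} is not an
   nzRingType, because the index type could be empty. *)
Definition fun_alg : Type := {ffun gT -> k^o}.

HB.instance Definition _ := Vector.copy fun_alg {ffun gT -> k^o}.
HB.instance Definition _ := GRing.PzRing.copy fun_alg {ffun gT -> k^o}.

Fact fun_alg_neq0 : (1 : fun_alg) != 0.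
Proof. by apply/eqP=> /ffunP/(_ 1%g)/eqP; rewrite !ffunE oner_eq0. Qed.

HB.instance Definition _ :=
  GRing.PzSemiRing_isNonZero.Build fun_alg fun_alg_neq0.

Fact fun_algAl (a : k) (x y : fun_alg) : a *: (x * y) = (a *: x) * y.
Proof. by apply/ffunP=> g; rewrite !ffunE; exact: mulrA. Qed.
HB.instance Definition _ := GRing.Lmodule_isLalgebra.Build k fun_alg fun_algAl.

Fact fun_algAr (a : k) (x y : fun_alg) : a *: (x * y) = x * (a *: y).
Proof. by apply/ffunP=> g; rewrite !ffunE; exact: mulrCA. Qed.
HB.instance Definition _ := GRing.Lalgebra_isAlgebra.Build k fun_alg fun_algAr.

HB.instance Definition _ := Algebra_isFalgebra.Build k fun_alg.

Definition fun_basis (g : gT) : fun_alg := delta k g.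

Definition fun_comul (f : fun_alg) : {ffun gT * gT -> k^o} :=
  [ffun p => f (p.1 * p.2)%g].

Definition fun_counit (f : fun_alg) : k^o := f 1%g.

Definition fun_antipode (f : fun_alg) : fun_alg := [ffun g => f g^-1%g].

Fact fun_basisK i : idfun (fun_basis i) = delta k i. Proof. by []. Qed.

Fact fun_coord_linear : linear (idfun : fun_alg -> {ffun gT -> k^o}).
Proof. by []. Qed.

Fact fun_coordK (x : fun_alg) : x = \sum_i (idfun x : {ffun _}) i *: fun_basis i.
Proof. exact: delta_sum. Qed.

Fact fun_comul_linear : linear fun_comul.
Proof. by move=> a x y; apply/ffunP=> p; rewrite !ffunE. Qed.

Fact fun_comulA (x : fun_alg) i j l :
  \sum_m fun_comul x (m, l) * fun_comul (fun_basis m) (i, j)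
  = \sum_m fun_comul x (i, m) * fun_comul (fun_basis m) (j, l).
Proof.
under eq_bigr do rewrite !ffunE /=.
under [RHS]eq_bigr do rewrite !ffunE /=.
rewrite (sum_dltr' _ (fun m => x (m * l)%g)).
by rewrite (sum_dltr' _ (fun m => x (i * m)%g)) mulgA.
Qed.

Fact fun_comul1 : fun_comul 1 = tens (idfun (1 : fun_alg)) (idfun (1 : fun_alg)).
Proof. by apply/ffunP=> p; rewrite !ffunE mulr1. Qed.

Fact fun_comulM (x y : fun_alg) :
  fun_comul (x * y) = \sum_p \sum_q (fun_comul x p * fun_comul y q) *:
    tens (idfun (fun_basis p.1 * fun_basis q.1))
         (idfun (fun_basis p.2 * fun_basis q.2)).
Proof.
apply/ffunP=> -[a b]; rewrite sum_ffunE.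
under eq_bigr=> p _.
  rewrite sum_ffunE.
  under eq_bigr => q _ do rewrite ffunE /= [X in _ *: X]ffunE /=.
  over.
rewrite (@tens_sumE k gT (fun p q r => (fun_basis p * fun_basis q) r)
  (fun p r => (p == r)%:R) (fun _ r => r)); last first.
  by move=> p q r; rewrite !ffunE (eq_sym p) (eq_sym q).
under eq_bigr=> i _.
  under eq_bigr=> j _ do rewrite -mulrA mulrCA -mulrA.
  rewrite -mulr_sumr sum_dlt.
  over.
by rewrite sum_dlt !ffunE.
Qed.

Fact fun_counit_linear : linear fun_counit.
Proof. by move=> a x y; rewrite /fun_counit !ffunE. Qed.

Fact fun_counit1 : fun_counit 1 = 1. Proof. by rewrite /fun_counit ffunE. Qed.

Fact fun_counitM : {morph fun_counit : x y / x * y}.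
Proof. by move=> x y; rewrite /fun_counit ffunE. Qed.

Fact fun_comul_counitl (x : fun_alg) :
  \sum_p (fun_comul x p * fun_counit (fun_basis p.1)) *: fun_basis p.2 = x.
Proof.
rewrite sum_pairE exchange_big /=.
rewrite [RHS]delta_sum; apply: eq_bigr => j _; rewrite -scaler_suml; congr (_ *: _).
rewrite /fun_counit; under eq_bigr do rewrite !ffunE /=.
by rewrite (sum_dltr' _ (fun i => x (i * j)%g)) mul1g.
Qed.

Fact fun_comul_counitr (x : fun_alg) :
  \sum_p (fun_comul x p * fun_counit (fun_basis p.2)) *: fun_basis p.1 = x.
Proof.
rewrite sum_pairE /=.
rewrite [RHS]delta_sum; apply: eq_bigr => j _; rewrite -scaler_suml; congr (_ *: _).
rewrite /fun_counit; under eq_bigr do rewrite !ffunE /=.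
by rewrite (sum_dltr' _ (fun i => x (j * i)%g)) mulg1.
Qed.

Fact fun_antipode_linear : linear fun_antipode.
Proof. by move=> a x y; apply/ffunP=> p; rewrite !ffunE. Qed.

Fact fun_antipodel (x : fun_alg) :
  \sum_p fun_comul x p *: (fun_antipode (fun_basis p.1) * fun_basis p.2)
  = (fun_counit x)%:A.
Proof.
apply/ffunP=> a; rewrite sum_ffunE.
under eq_bigr do rewrite !ffunE.
rewrite sum_pairE /=.
under eq_bigr=> i _.
  under eq_bigr=> j _ do rewrite [_ *: _]mulrA.
  rewrite (sum_dltr' a (fun j => x (i * j)%g * _)) /=.
  over.
by rewrite (sum_dltr' _ (fun i => x (i * a)%g)) !ffunE mulVg; exact/esym/mulr1.
Qed.

Fact fun_antipoder (x : fun_alg) :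
  \sum_p fun_comul x p *: (fun_basis p.1 * fun_antipode (fun_basis p.2))
  = (fun_counit x)%:A.
Proof.
apply/ffunP=> a; rewrite sum_ffunE.
under eq_bigr do rewrite !ffunE.
rewrite sum_pairE /=.
under eq_bigr=> i _.
  under eq_bigr=> j _ do rewrite [_ *: _]mulrA.
  rewrite (sum_dltr' a^-1%g (fun j => x (i * j)%g * _)) /=.
  over.
by rewrite (sum_dltr' _ (fun i => x (i * a^-1)%g)) !ffunE mulgV; exact/esym/mulr1.
Qed.

HB.instance Definition _ := @isHopfAlgebra.Build k fun_alg gT
  fun_basis idfun fun_coord_linear fun_basisK fun_coordK
  fun_comul fun_comul_linear fun_comulA fun_comul1 fun_comulM
  fun_counit fun_counit_linear fun_counit1 fun_counitM
  fun_comul_counitl fun_comul_counitr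
  fun_antipode fun_antipode_linear fun_antipodel fun_antipoder.
End FunAlgebra.

Section GroupAlgebra.
Variables (k : fieldType) (gT : finGroupType).

Definition grp_alg : Type := {ffun gT -> k^o}.

HB.instance Definition _ := Vector.copy grp_alg {ffun gT -> k^o}.

Definition grp_basis (g : gT) : grp_alg := delta k g.

Definition grp_mul (x y : grp_alg) : grp_alg :=
  [ffun g => \sum_h x h * y (h^-1 * g)%g].

Fact grp_mul_basisE (p q r : gT) :
  grp_mul (grp_basis p) (grp_basis q) r = (q == p^-1 * r)%g%:R.
Proof.
rewrite ffunE; under eq_bigr do rewrite !ffunE.
by rewrite (sum_dlt p (fun h => (h^-1 * r == q)%g%:R)) eq_sym.
Qed.

Lemma grp_mul_basis (g h : gT) :
  grp_mul (grp_basis g) (grp_basis h) = grp_basis (g * h)%g.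
Proof.
by apply/ffunP=> r; rewrite grp_mul_basisE ffunE -(inj_eq (mulgI g)) mulKVg eq_sym.
Qed.

Fact grp_mulA : associative grp_mul.
Proof.
move=> x y z; apply/ffunP=> g; rewrite !ffunE.
under eq_bigr do rewrite ffunE mulr_sumr.
under [RHS]eq_bigr do rewrite ffunE mulr_suml.
rewrite [RHS]exchange_big /=; apply: eq_bigr => h _.
rewrite [RHS](reindex_inj (mulgI h)) /=; apply: eq_bigr => l _.
by rewrite mulKg invMg mulgA mulrA.
Qed.

Fact grp_mul1l : left_id (grp_basis 1%g) grp_mul.
Proof.
move=> x; apply/ffunP=> g; rewrite ffunE.
under eq_bigr do rewrite ffunE.
by rewrite (sum_dlt 1%g (fun h => x (h^-1 * g)%g)) invg1 mul1g.
Qed.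

Fact grp_mul1r : right_id (grp_basis 1%g) grp_mul.
Proof.
move=> x; apply/ffunP=> g; rewrite ffunE.
under eq_bigr => h _ do
  rewrite ffunE -eq_invg_mul invgK.
exact: sum_dltr.
Qed.

Fact grp_mulDl : left_distributive grp_mul +%R.
Proof.
move=> x y z; apply/ffunP=> g; rewrite !ffunE -big_split /=.
by apply: eq_bigr => h _; rewrite ffunE mulrDl.
Qed.

Fact grp_mulDr : right_distributive grp_mul +%R.
Proof.
move=> x y z; apply/ffunP=> g; rewrite !ffunE -big_split /=.
by apply: eq_bigr => h _; rewrite ffunE mulrDr.
Qed.

Fact grp_alg_neq0 : grp_basis 1%g != 0.
Proof. by apply/eqP=> /ffunP/(_ 1%g)/eqP; rewrite !ffunE eqxx oner_eq0. Qed.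

HB.instance Definition _ := GRing.Zmodule_isNzRing.Build grp_alg
  grp_mulA grp_mul1l grp_mul1r grp_mulDl grp_mulDr grp_alg_neq0.

Fact grp_algAl (a : k) (x y : grp_alg) : a *: (x * y) = (a *: x) * y.
Proof.
apply/ffunP=> g; rewrite !ffunE scaler_sumr; apply: eq_bigr => h _.
by rewrite !ffunE; exact: mulrA.
Qed.
HB.instance Definition _ := GRing.Lmodule_isLalgebra.Build k grp_alg grp_algAl.

Fact grp_algAr (a : k) (x y : grp_alg) : a *: (x * y) = x * (a *: y).
Proof.
apply/ffunP=> g; rewrite !ffunE scaler_sumr; apply: eq_bigr => h _.
by rewrite !ffunE; exact: mulrCA.
Qed.
HB.instance Definition _ := GRing.Lalgebra_isAlgebra.Build k grp_alg grp_algAr.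

HB.instance Definition _ := Algebra_isFalgebra.Build k grp_alg.

Definition grp_comul (x : grp_alg) : {ffun gT * gT -> k^o} :=
  [ffun p => x p.1 * (p.1 == p.2)%:R].

Definition grp_counit (x : grp_alg) : k^o := \sum_g x g.

Definition grp_antipode (x : grp_alg) : grp_alg := [ffun g => x g^-1%g].

Fact grp_basisK i : idfun (grp_basis i) = delta k i. Proof. by []. Qed.

Fact grp_coord_linear : linear (idfun : grp_alg -> {ffun gT -> k^o}).
Proof. by []. Qed.

Fact grp_coordK (x : grp_alg) : x = \sum_i (idfun x : {ffun _}) i *: grp_basis i.
Proof. exact: delta_sum. Qed.

Fact grp_comul_linear : linear grp_comul.
Proof.
by move=> a x y; apply/ffunP=> p; rewrite !ffunE mulrDl; congr (_ + _);
  exact/esym/mulrA.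
Qed.

Lemma grp_comul_basis (g : gT) :
  grp_comul (grp_basis g) = tens (grp_basis g) (grp_basis g).
Proof.
apply/ffunP=> -[a b]; rewrite !ffunE /= eq_sym (eq_sym b).
by case: eqP => [->|]; rewrite ?mul0r.
Qed.

Fact grp_comulA (x : grp_alg) i j l :
  \sum_m grp_comul x (m, l) * grp_comul (grp_basis m) (i, j)
  = \sum_m grp_comul x (i, m) * grp_comul (grp_basis m) (j, l).
Proof.
under eq_bigr do rewrite !ffunE /= mulrCA.
under [RHS]eq_bigr do rewrite !ffunE /= mulrCA.
rewrite (sum_dlt' i (fun m => x m * (m == l)%:R * (i == j)%:R)).
rewrite (sum_dlt' j (fun m => x i * (i == m)%:R * (j == l)%:R)) mulrAC.
by case: (i =P j) => [->|_] //; rewrite !mulr0 !mul0r.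
Qed.

Fact grp_comul1 : grp_comul 1 = tens (idfun (1 : grp_alg)) (idfun (1 : grp_alg)).
Proof. exact: grp_comul_basis. Qed.

Fact grp_comulM (x y : grp_alg) :
  grp_comul (x * y) = \sum_p \sum_q (grp_comul x p * grp_comul y q) *:
    tens (idfun (grp_basis p.1 * grp_basis q.1))
         (idfun (grp_basis p.2 * grp_basis q.2)).
Proof.
apply/ffunP=> -[a b]; rewrite sum_ffunE.
under eq_bigr=> p _.
  rewrite sum_ffunE.
  under eq_bigr => q _ do rewrite ffunE /= [X in _ *: X]ffunE /=.
  over.
rewrite (@tens_sumE k gT (fun p q r => (grp_basis p * grp_basis q) r)
  (fun p r => 1) (fun p r => p^-1 * r)%g); last first.
  by move=> p q r; rewrite mul1r; exact: grp_mul_basisE.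
rewrite !ffunE /= mulr_suml; apply: eq_bigr => i _.
under eq_bigr=> j _ do rewrite !ffunE /= !mulr1 -mulrA mulrCA.
rewrite (sum_dlt' i (fun j => x i * (y (i^-1 * a)%g *
  (i^-1 * a == j^-1 * b)%g%:R))) (inj_eq (mulgI _)).
exact/esym/mulrA.
Qed.

Fact grp_counit_linear : linear grp_counit.
Proof.
move=> a x y; rewrite /grp_counit scaler_sumr -big_split /=.
by apply: eq_bigr => g _; rewrite !ffunE.
Qed.

Lemma grp_counit_basis g : grp_counit (grp_basis g) = 1.
Proof.
rewrite /grp_counit; under eq_bigr do rewrite ffunE -[_%:R]mulr1.
exact: (sum_dlt g (fun=> 1)).
Qed.

Fact grp_counit1 : grp_counit 1 = 1. Proof. exact: grp_counit_basis. Qed.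

Fact grp_counitM : {morph grp_counit : x y / x * y}.
Proof.
move=> x y; rewrite /grp_counit mulr_suml.
under eq_bigr do rewrite ffunE.
rewrite exchange_big /=; apply: eq_bigr => h _.
by rewrite -mulr_sumr; congr (_ * _); rewrite [RHS](reindex_inj (mulgI h^-1%g)).
Qed.

Fact grp_comul_counitl (x : grp_alg) :
  \sum_p (grp_comul x p * grp_counit (grp_basis p.1)) *: grp_basis p.2 = x.
Proof.
rewrite sum_pairE exchange_big /=.
rewrite [RHS]delta_sum; apply: eq_bigr => j _; rewrite -scaler_suml; congr (_ *: _).
under eq_bigr do rewrite !ffunE /= grp_counit_basis mulr1.
exact: sum_dltr.
Qed.

Fact grp_comul_counitr (x : grp_alg) :
  \sum_p (grp_comul x p * grp_counit (grp_basis p.2)) *: grp_basis p.1 = x.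
Proof.
rewrite sum_pairE /=.
rewrite [RHS]delta_sum; apply: eq_bigr => j _; rewrite -scaler_suml; congr (_ *: _).
under eq_bigr do rewrite !ffunE /= grp_counit_basis mulr1.
exact: (sum_dltr' j (fun=> x j)).
Qed.

Fact grp_antipode_linear : linear grp_antipode.
Proof. by move=> a x y; apply/ffunP=> p; rewrite !ffunE. Qed.

Lemma grp_antipode_basis g : grp_antipode (grp_basis g) = grp_basis g^-1%g.
Proof. by apply/ffunP=> h; rewrite !ffunE (canF_eq invgK). Qed.

Fact grp_antipodel (x : grp_alg) :
  \sum_p grp_comul x p *: (grp_antipode (grp_basis p.1) * grp_basis p.2)
  = (grp_counit x)%:A.
Proof.
rewrite sum_pairE scaler_suml; apply: eq_bigr => i _ /=.
rewrite (bigD1 i) //= big1 => [|j /negPf ji]; last first.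
  by rewrite ffunE /= eq_sym ji mulr0 scale0r.
rewrite addr0 ffunE eqxx mulr1 grp_antipode_basis [_ * _]grp_mul_basis.
by rewrite mulVg.
Qed.

Fact grp_antipoder (x : grp_alg) :
  \sum_p grp_comul x p *: (grp_basis p.1 * grp_antipode (grp_basis p.2))
  = (grp_counit x)%:A.
Proof.
rewrite sum_pairE scaler_suml; apply: eq_bigr => i _ /=.
rewrite (bigD1 i) //= big1 => [|j /negPf ji]; last first.
  by rewrite ffunE /= eq_sym ji mulr0 scale0r.
rewrite addr0 ffunE eqxx mulr1 grp_antipode_basis [_ * _]grp_mul_basis.
by rewrite mulgV.
Qed.

HB.instance Definition _ := @isHopfAlgebra.Build k grp_alg gT
  grp_basis idfun grp_coord_linear grp_basisK grp_coordK
  grp_comul grp_comul_linear grp_comulA grp_comul1 grp_comulM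
  grp_counit grp_counit_linear grp_counit1 grp_counitM
  grp_comul_counitl grp_comul_counitr
  grp_antipode grp_antipode_linear grp_antipodel grp_antipoder.
End GroupAlgebra.

Section DrinfeldDouble.
Variables (k : fieldType) (gT : finGroupType).

Definition drinfeld : Type := {ffun gT * gT -> k^o}.

HB.instance Definition _ := Vector.copy drinfeld {ffun gT * gT -> k^o}.

Definition smash (a : fun_alg k gT) (b : grp_alg k gT) : drinfeld := tens a b.

(* drinfeld_basis (g, h) is e_g # h *)
Definition drinfeld_basis (p : gT * gT) : drinfeld := delta k p.

Lemma smash_basis (g h : gT) :
  smash (fun_basis k g) (grp_basis k h) = drinfeld_basis (g, h).
Proof. by apply/ffunP=> -[a b]; rewrite !ffunE /= xpair_eqE -mulnb natrM. Qed.

Definition drinfeld_mul (x y : drinfeld) : drinfeld :=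
  [ffun p => \sum_h x (p.1, h) * y (p.1 ^ h, h^-1 * p.2)%g].

Definition drinfeld_one : drinfeld := smash 1 1.

Fact drinfeld_mul_basisE (p q r : gT * gT) :
  drinfeld_mul (drinfeld_basis p) (drinfeld_basis q) r =
  (p.1 == r.1)%:R * (q == (r.1 ^ p.2, p.2^-1 * r.2))%g%:R.
Proof.
rewrite ffunE; under eq_bigr do rewrite !ffunE /= -pair_eqE /= -mulnb natrM -mulrA.
rewrite -mulr_sumr (eq_sym r.1) (eq_sym q); congr (_ * _).
exact: (sum_dlt p.2 (fun h => ((r.1 ^ h, h^-1 * r.2)%g == q)%:R)).
Qed.

Lemma drinfeld_mul_basis (g g' h h' : gT) :
  drinfeld_mul (drinfeld_basis (g, g')) (drinfeld_basis (h, h')) =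
  (g == g' * h * g'^-1)%g%:R *: drinfeld_basis (g, g' * h')%g.
Proof.
apply/ffunP=> -[a b]; rewrite drinfeld_mul_basisE !ffunE /=.
rewrite !xpair_eqE -!mulnb !natrM (eq_sym a).
rewrite -(inj_eq (mulgI g') h') mulKVg (eq_sym b).
case: (g =P a) => [->|_]; last by rewrite !mul0r; exact/esym/mulr0.
rewrite !mul1r (eq_sym h) (canF_eq (conjgK _)) /conjg; congr (_%:R * _).
by rewrite invgK mulgA.
Qed.

Fact drinfeld_mulA : associative drinfeld_mul.
Proof.
move=> x y z; apply/ffunP=> -[a g]; rewrite !ffunE /=.
under eq_bigr do rewrite ffunE mulr_sumr /=.
under [RHS]eq_bigr do rewrite ffunE mulr_suml /=.
rewrite [RHS]exchange_big /=; apply: eq_bigr => h _.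
rewrite [RHS](reindex_inj (mulgI h)) /=; apply: eq_bigr => l _.
by rewrite mulKg invMg mulgA mulrA conjgM.
Qed.

Fact drinfeld_mul1l : left_id drinfeld_one drinfeld_mul.
Proof.
move=> x; apply/ffunP=> -[a g]; rewrite ffunE /=.
under eq_bigr do rewrite !ffunE mul1r /=.
rewrite (sum_dlt 1%g (fun h => x (a ^ h, h^-1 * g)%g)).
by rewrite conjg1 invg1 mul1g.
Qed.

Fact drinfeld_mul1r : right_id drinfeld_one drinfeld_mul.
Proof.
move=> x; apply/ffunP=> -[a g]; rewrite ffunE /=.
under eq_bigr do rewrite !ffunE mul1r /= -eq_invg_mul invgK.
exact: (sum_dltr g (fun h => x (a, h))).
Qed.

Fact drinfeld_mulDl : left_distributive drinfeld_mul +%R.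
Proof.
move=> x y z; apply/ffunP=> g; rewrite !ffunE -big_split /=.
by apply: eq_bigr => h _; rewrite ffunE mulrDl.
Qed.

Fact drinfeld_mulDr : right_distributive drinfeld_mul +%R.
Proof.
move=> x y z; apply/ffunP=> g; rewrite !ffunE -big_split /=.
by apply: eq_bigr => h _; rewrite ffunE mulrDr.
Qed.

Fact drinfeld_neq0 : drinfeld_one != 0.
Proof.
apply/eqP=> /ffunP/(_ (1%g, 1%g))/eqP; rewrite !ffunE eqxx mulr1.
by rewrite oner_eq0.
Qed.

HB.instance Definition _ := GRing.Zmodule_isNzRing.Build drinfeld
  drinfeld_mulA drinfeld_mul1l drinfeld_mul1r drinfeld_mulDl drinfeld_mulDr
  drinfeld_neq0.

Fact drinfeldAl (a : k) (x y : drinfeld) : a *: (x * y) = (a *: x) * y.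
Proof.
apply/ffunP=> g; rewrite !ffunE scaler_sumr; apply: eq_bigr => h _.
by rewrite !ffunE; exact: mulrA.
Qed.
HB.instance Definition _ := GRing.Lmodule_isLalgebra.Build k drinfeld drinfeldAl.

Fact drinfeldAr (a : k) (x y : drinfeld) : a *: (x * y) = x * (a *: y).
Proof.
apply/ffunP=> g; rewrite !ffunE scaler_sumr; apply: eq_bigr => h _.
by rewrite !ffunE; exact: mulrCA.
Qed.
HB.instance Definition _ := GRing.Lalgebra_isAlgebra.Build k drinfeld drinfeldAr.

HB.instance Definition _ := Algebra_isFalgebra.Build k drinfeld.

Definition drinfeld_comul (x : drinfeld) :
    {ffun (gT * gT) * (gT * gT) -> k^o} :=
  [ffun q => x (q.2.1 * q.1.1, q.1.2)%g * (q.1.2 == q.2.2)%:R].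

Lemma drinfeld_comul_basis (g h : gT) :
  drinfeld_comul (drinfeld_basis (g, h)) =
  \sum_(ab : gT * gT | (ab.1 * ab.2 == g)%g)
    tens (drinfeld_basis (ab.2, h)) (drinfeld_basis (ab.1, h)).
Proof.
apply/ffunP=> -[[c d] [c' d']]; rewrite sum_ffunE !ffunE /=.
under eq_bigr do rewrite !ffunE /= !xpair_eqE -!mulnb !natrM.
rewrite big_mkcond /= (bigD1 (c', c)) //= big1 => [|[a b]]; last first.
  rewrite xpair_eqE negb_and (eq_sym a) (eq_sym b) /=.
  by case: ifP => // _ /orP[]/negPf->; rewrite ?mul0r ?mulr0.
rewrite addr0 !eqxx !mul1r xpair_eqE.
case: ifP => _ /=; last by rewrite mul0r.
by rewrite -!natrM !mulnb; case: (d =P h) => [->|] //=; rewrite eq_sym.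
Qed.

Definition drinfeld_counit (x : drinfeld) : k^o := \sum_h x (1%g, h).

Lemma drinfeld_counit_basis (g h : gT) :
  drinfeld_counit (drinfeld_basis (g, h)) = (g == 1%g)%:R.
Proof.
rewrite /drinfeld_counit.
under eq_bigr do rewrite ffunE xpair_eqE -mulnb natrM.
by rewrite (sum_dltr h (fun=> _)) eq_sym.
Qed.

(* S(e_g # h) = (1 # h^-1) (e_(g^-1) # 1) *)
Definition drinfeld_antipode (x : drinfeld) : drinfeld :=
  [ffun p => x (p.1^-1 ^ p.2, p.2^-1)%g].

Lemma drinfeld_antipode_basis (g h : gT) :
  drinfeld_antipode (drinfeld_basis (g, h)) =
  drinfeld_basis (g^-1 ^ h, h^-1)%g.
Proof.
apply/ffunP=> -[a b]; rewrite !ffunE /= !xpair_eqE (canF_eq invgK).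
case: (b =P _) => [->|]; rewrite ?andbF // !andbT.
by rewrite (canF_eq (conjgKV _)) (canF_eq invgK) conjVg.
Qed.

Fact drinfeld_basisK i : idfun (drinfeld_basis i) = delta k i. Proof. by []. Qed.

Fact drinfeld_coord_linear :
  linear (idfun : drinfeld -> {ffun gT * gT -> k^o}).
Proof. by []. Qed.

Fact drinfeld_coordK (x : drinfeld) :
  x = \sum_i (idfun x : {ffun _}) i *: drinfeld_basis i.
Proof. exact: delta_sum. Qed.

Fact drinfeld_comul_linear : linear drinfeld_comul.
Proof.
by move=> a x y; apply/ffunP=> p; rewrite !ffunE mulrDl; congr (_ + _);
  exact/esym/mulrA.
Qed.

Fact drinfeld_comulA (x : drinfeld) i j l :
  \sum_m drinfeld_comul x (m, l) * drinfeld_comul (drinfeld_basis m) (i, j)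
  = \sum_m drinfeld_comul x (i, m) * drinfeld_comul (drinfeld_basis m) (j, l).
Proof.
under eq_bigr do rewrite !ffunE /= mulrCA.
under [RHS]eq_bigr do rewrite !ffunE /= mulrCA.
rewrite (sum_dlt' (j.1 * i.1, i.2)%g
  (fun m => x (l.1 * m.1, m.2)%g * (m.2 == l.2)%:R * (i.2 == j.2)%:R)) /=.
rewrite (sum_dlt' (l.1 * j.1, j.2)%g
  (fun m => x (m.1 * i.1, i.2)%g * (i.2 == m.2)%:R * (j.2 == l.2)%:R)) /=.
rewrite mulgA mulrAC.
by case: (i.2 =P j.2) => [->|_] //; rewrite !mulr0 !mul0r.
Qed.

Fact drinfeld_comul1 :
  drinfeld_comul 1 = tens (idfun (1 : drinfeld)) (idfun (1 : drinfeld)).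
Proof.
apply/ffunP=> -[[a b] [c d]]; rewrite !ffunE /= !mul1r.
by case: (b =P 1%g) => [->|]; rewrite ?mul0r // eq_sym.
Qed.

Fact drinfeld_comulM (x y : drinfeld) :
  drinfeld_comul (x * y) =
  \sum_p \sum_q (drinfeld_comul x p * drinfeld_comul y q) *:
    tens (idfun (drinfeld_basis p.1 * drinfeld_basis q.1))
         (idfun (drinfeld_basis p.2 * drinfeld_basis q.2)).
Proof.
apply/ffunP=> -[a b]; rewrite sum_ffunE.
under eq_bigr=> p _.
  rewrite sum_ffunE.
  under eq_bigr => q _ do rewrite ffunE /= [X in _ *: X]ffunE /=.
  over.
rewrite (@tens_sumE k (gT * gT)%type
  (fun p q r => (drinfeld_basis p * drinfeld_basis q) r)
  (fun p r => (p.1 == r.1)%:R)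
  (fun p r => (r.1 ^ p.2, p.2^-1 * r.2)%g)); last first.
  by move=> p q r; exact: drinfeld_mul_basisE.
pose G i j := x (j.1 * i.1, i.2)%g *
  drinfeld_comul y ((a.1 ^ i.2, i.2^-1 * a.2), (b.1 ^ j.2, j.2^-1 * b.2))%g.
transitivity (\sum_i (i.1 == a.1)%:R *
  \sum_j (j == (b.1, i.2))%:R * G i j : k); last first.
  apply: eq_bigr => i _; rewrite mulr_sumr; apply: eq_bigr => j _.
  rewrite [drinfeld_comul x _]ffunE /=.
  rewrite -pair_eqE /= -mulnb natrM (eq_sym j.2) /G; ring.
under eq_bigr=> i _ do rewrite sum_dlt.
rewrite sum_pairE exchange_big /= ffunE ffunE /= mulr_suml.
apply: eq_bigr => h _.
rewrite (sum_dlt a.1 (fun i => G (i, h) (b.1, h))) /G ffunE /= conjMg.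
by rewrite (inj_eq (mulgI _)); exact/esym/mulrA.
Qed.

Fact drinfeld_counit_linear : linear drinfeld_counit.
Proof.
move=> a x y; rewrite /drinfeld_counit scaler_sumr -big_split /=.
by apply: eq_bigr => g _; rewrite !ffunE.
Qed.

Fact drinfeld_counit1 : drinfeld_counit 1 = 1.
Proof.
rewrite /drinfeld_counit; under eq_bigr do rewrite !ffunE mulrC /=.
exact: (sum_dlt 1%g (fun=> 1)).
Qed.

Fact drinfeld_counitM : {morph drinfeld_counit : x y / x * y}.
Proof.
move=> x y; rewrite /drinfeld_counit mulr_suml.
under eq_bigr do rewrite ffunE.
rewrite exchange_big /=; apply: eq_bigr => h _.
rewrite -mulr_sumr; congr (_ * _); rewrite [RHS](reindex_inj (mulgI h^-1%g)).
by apply: eq_bigr => g _; rewrite conj1g.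
Qed.

Fact drinfeld_comul_counitl (x : drinfeld) :
  \sum_p (drinfeld_comul x p * drinfeld_counit (drinfeld_basis p.1)) *:
    drinfeld_basis p.2 = x.
Proof.
rewrite sum_pairE exchange_big /= [RHS]delta_sum.
apply: eq_bigr => -[b h] _; rewrite -scaler_suml; congr (_ *: _).
rewrite sum_pairE exchange_big /=.
under eq_bigr=> l _.
  under eq_bigr=> a _ do rewrite ffunE /= drinfeld_counit_basis mulrC.
  rewrite (sum_dlt 1%g (fun a => x (b * a, l)%g * (l == h)%:R)) mulg1.
  over.
exact: (sum_dltr h (fun l => x (b, l))).
Qed.

Fact drinfeld_comul_counitr (x : drinfeld) :
  \sum_p (drinfeld_comul x p * drinfeld_counit (drinfeld_basis p.2)) *:
    drinfeld_basis p.1 = x.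
Proof.
rewrite sum_pairE /= [RHS]delta_sum.
apply: eq_bigr => -[b h] _; rewrite -scaler_suml; congr (_ *: _).
rewrite sum_pairE exchange_big /=.
under eq_bigr=> l _.
  under eq_bigr=> a _ do rewrite ffunE /= drinfeld_counit_basis mulrC.
  rewrite (sum_dlt 1%g (fun a => x (a * b, h)%g * (h == l)%:R)) mul1g.
  over.
exact: (sum_dltr' h (fun l => x (b, h))).
Qed.

Fact drinfeld_antipode_linear : linear drinfeld_antipode.
Proof. by move=> a x y; apply/ffunP=> p; rewrite !ffunE. Qed.

Fact drinfeld_antipodel (x : drinfeld) :
  \sum_p drinfeld_comul x p *:
    (drinfeld_antipode (drinfeld_basis p.1) * drinfeld_basis p.2)
  = (drinfeld_counit x)%:A.
Proof.
apply/ffunP=> -[c d]; rewrite sum_ffunE sum_pairE.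
pose G (i j : gT * gT) : k := x (j.1 * i.1, i.2)%g * (d == 1%g)%:R.
transitivity (\sum_i (i.1 == (c^-1) ^ i.2^-1)%g%:R *
  \sum_j (j == (c ^ i.2^-1, i.2))%g%:R * G i j : k).
  apply: eq_bigr => -[g h] _; rewrite mulr_sumr; apply: eq_bigr => -[g' h'] _.
  rewrite drinfeld_antipode_basis ffunE [drinfeld_comul x _]ffunE /=.
  rewrite [X in _ *: X]drinfeld_mul_basisE /= !xpair_eqE.
  rewrite /G /= -!mulnb !natrM.
  have -> : (g == c^-1 ^ h^-1)%g = (g^-1 ^ h == c)%g.
    by rewrite (canF_eq (conjgK _)) (canF_eq invgK) conjVg.
  rewrite invgK.
  case: (h' =P h) => [->|/eqP/negPf hh]; last first.
    by rewrite eq_sym hh !(mulr0, mul0r) scale0r.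
  have -> : (h == h * d)%g = (d == 1%g).
    by rewrite -{1}[h]mulg1 (inj_eq (mulgI _)) eq_sym.
  rewrite eqxx mulr1n; change (_ *: _) with (x (g' * g, h)%g * 1 * ((g^-1 ^ h == c)%g%:R * ((g' == c ^ h^-1)%g%:R * (d == 1%g)%:R)) : k).
  ring.
under eq_bigr=> i _ do rewrite sum_dlt /G /=.
rewrite sum_pairE exchange_big /= !ffunE /= mul1r.
rewrite (_ : _ *: _ = drinfeld_counit x * (d == 1%g)%:R) // mulr_suml.
apply: eq_bigr => h _.
rewrite (sum_dlt _ (fun g => x (c ^ h^-1 * g, h)%g * (d == 1%g)%:R)).
by rewrite -conjMg mulgV conj1g.
Qed.

Fact drinfeld_antipoder (x : drinfeld) :
  \sum_p drinfeld_comul x p *: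
    (drinfeld_basis p.1 * drinfeld_antipode (drinfeld_basis p.2))
  = (drinfeld_counit x)%:A.
Proof.
apply/ffunP=> -[c d]; rewrite sum_ffunE sum_pairE.
pose G (i j : gT * gT) : k := x (j.1 * i.1, i.2)%g * (d == 1%g)%:R.
transitivity (\sum_i (i.1 == c)%:R *
  \sum_j (j == (c^-1, i.2))%g%:R * G i j : k).
  apply: eq_bigr => -[g h] _; rewrite mulr_sumr; apply: eq_bigr => -[g' h'] _.
  rewrite drinfeld_antipode_basis ffunE [drinfeld_comul x _]ffunE /=.
  rewrite [X in _ *: X]drinfeld_mul_basisE /= !xpair_eqE.
  rewrite /G /= -!mulnb !natrM.
  case: (h' =P h) => [->|/eqP/negPf hh]; last first.
    by rewrite eq_sym hh !(mulr0, mul0r) scale0r.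
  rewrite (inj_eq (conjg_inj _)) (canF_eq invgK).
  have -> : (h^-1 == h^-1 * d)%g = (d == 1%g).
    by rewrite -{1}[h^-1%g]mulg1 (inj_eq (mulgI _)) eq_sym.
  rewrite eqxx mulr1n; change (_ *: _) with (x (g' * g, h)%g * 1 * ((g == c)%:R * ((g' == c^-1)%g%:R * (d == 1%g)%:R)) : k).
  ring.
under eq_bigr=> i _ do rewrite sum_dlt /G /=.
rewrite sum_pairE exchange_big /= !ffunE /= mul1r.
rewrite (_ : _ *: _ = drinfeld_counit x * (d == 1%g)%:R) // mulr_suml.
apply: eq_bigr => h _.
rewrite (sum_dlt _ (fun g => x (c^-1 * g, h)%g * (d == 1%g)%:R)).
by rewrite mulVg.
Qed.

HB.instance Definition _ := @isHopfAlgebra.Build k drinfeld (gT * gT)%type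
  drinfeld_basis idfun drinfeld_coord_linear drinfeld_basisK drinfeld_coordK
  drinfeld_comul drinfeld_comul_linear drinfeld_comulA drinfeld_comul1
  drinfeld_comulM
  drinfeld_counit drinfeld_counit_linear drinfeld_counit1 drinfeld_counitM
  drinfeld_comul_counitl drinfeld_comul_counitr
  drinfeld_antipode drinfeld_antipode_linear
  drinfeld_antipodel drinfeld_antipoder.
End DrinfeldDouble.

Section Automorphisms.
Variables (k : fieldType) (gT : finGroupType).
Notation D := (drinfeld k gT).
Notation kG := (grp_alg k gT).
Notation dualG := (fun_alg k gT).

(* id (x) epsilon and ev_1 (x) id on k^G (x) kG *)
Definition id_counit (t : D) : dualG := [ffun g => counit (slice t g : kG)].
Definition ev1_id (t : D) : kG := slice t 1%g.

Definition comp_u (psi : D -> D) (a : dualG) : dualG :=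
  id_counit (psi (smash a 1)).
Definition comp_p (psi : D -> D) (a : dualG) : kG :=
  ev1_id (psi (smash a 1)).
Definition comp_r (psi : D -> D) (g : gT) : dualG :=
  id_counit (psi (smash 1 (grp_basis k g))).
Definition comp_v (psi : D -> D) (g : gT) : kG :=
  ev1_id (psi (smash 1 (grp_basis k g))).

(* The linear map a # g |-> u(a_1) r(g) # p(a_2) v(g), where a_1 (x) a_2 is the
   coproduct of (k^G)^cop: the coefficient of e_x (x) e_y in it is that of
   e_y (x) e_x in comul a. *)
Definition of_components (p : dualG -> kG) (u : dualG -> dualG)
    (r : gT -> dualG) (v : gT -> kG) (x : D) : D :=
  \sum_(t : gT * gT) x t *: \sum_(s : gT * gT)
    comul (fun_basis k t.1) (s.2, s.1) *:
      smash (u (fun_basis k s.1) * r t.2) (p (fun_basis k s.2) * v t.2).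

(* chi g != 0 follows, so these are the homomorphisms from G to k^x *)
Definition is_character (chi : dualG) : Prop :=
  chi 1%g = 1 /\ {morph chi : g h / (g * h)%g >-> g * h}.

Definition is_hom_to_characters (r : gT -> dualG) : Prop :=
  (forall g, is_character (r g)) /\ {morph r : g h / (g * h)%g >-> g * h}.

Definition is_group_aut (v : gT -> kG) : Prop :=
  exists2 w : {perm gT}, w \in Aut [set: gT] &
    forall g, v g = grp_basis k (w g).

Definition p_trivial (psi : D -> D) : Prop :=
  forall a : dualG, comp_p psi a = a 1%g *: grp_basis k 1%g.

Definition r_trivial (psi : D -> D) : Prop := forall g, comp_r psi g = 1.

Definition AutD (psi : 'End(D)) : Prop := hopf_aut psi.

Definition Lambda (psi : 'End(D)) : Prop :=
  [/\ AutD psi, forall a, comp_u psi a = a,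
      forall g, comp_v psi g = grp_basis k g & r_trivial psi].

Definition AutD_p_trivial (psi : 'End(D)) : Prop :=
  AutD psi /\ p_trivial psi.

Definition SpAutc (psi : 'End(D)) : Prop :=
  exists w v : {perm gT},
    [/\ w \in Aut [set: gT], v \in Aut [set: gT],
        forall g, ((w^-1)%g (v g) * g^-1)%g \in 'Z([set: gT])%g &
        forall g h, psi (smash (fun_basis k g) (grp_basis k h)) =
                    smash (fun_basis k (w g)) (grp_basis k (v h))].

Definition HomGGhat (psi : 'End(D)) : Prop :=
  exists2 r : gT -> dualG, is_hom_to_characters r &
    forall g h, psi (smash (fun_basis k g) (grp_basis k h)) =
                smash (r h * fun_basis k g) (grp_basis k h).

End Automorphisms.

Section Factorizations.
Variables (k : fieldType) (V : vectType k).
Implicit Types X Y Z H N : 'End(V) -> Prop.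

Definition end_group X : Prop :=
  [/\ X \1%VF, forall f g, X f -> X g -> X (f \o g)%VF &
      forall f, X f ->
        exists g, [/\ X g, (f \o g = \1)%VF & (g \o f = \1)%VF]].

Definition exact_factorization X Y Z : Prop :=
  [/\ end_group X, end_group Y, end_group Z,
      forall f, X f <-> exists g h, [/\ Y g, Z h & f = (g \o h)%VF] &
      forall f, Y f -> Z f -> f = \1%VF].

(* X is the internal semidirect product of H and the normal subgroup N *)
Definition internal_semidirect X H N : Prop :=
  exact_factorization X H N /\
  forall f n, X f -> N n -> N (f \o n \o f^-1)%VF.

End Factorizations.

Definition purely_nonabelian (gT : finGroupType) : Prop :=
  forall A B : {group gT}, (A \x B)%g = [set: gT] -> abelian A -> A :=: 1%g.

(* Main.v *)
From HB Require Import structures.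
Require Import Defs.
From mathcomp Require Import all_boot all_order all_algebra all_fingroup.
From mathcomp Require Import all_solvable all_field.
From mathcomp Require Import ring.

Set Implicit Arguments.
Unset Strict Implicit.
Unset Printing Implicit Defensive.

Import GRing.Theory.
Local Open Scope ring_scope.

(* For an automorphism psi = (p, u, r, v) with inverse (p', u', r', v'), the
   coproduct makes u and p cocommute, and the u-component of psi^-1 psi = id
   upgrades this to a_1 (x) p(a_2) = a_2 (x) p(a_1), so p is invariant under
   conjugation. Since psi psi^-1 = id gives g = p(r'(g)) v(v'(g)) with
   p(r'(g)) central, p takes values in k Z(G); hence u is multiplicative, that is
   u(f) = f o w for an endomorphism w of G, and both v o v' and w o w' are
   central endomorphisms. These are injective when G is purely non-abelian, by
   Fitting's lemma; this is (i) => (ii).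
   If u is bijective then psi = lambda kappa with lambda in Lambda and
   kappa = (1, u, r, vt) for vt(g) = p(u^-1(r(g))^-1) v(g). Replacing r by r'
   only changes kappa, and the new vt is the v-component of psi (1, 1, s, 1)
   for s = u^-1(r'(-))^-1, whence (ii) => (iii). Conversely (iii) with r' = 1
   forces u to be bijective, whence (iii) => (iv).
   If G has a cyclic direct factor C, the Fourier transform k^C -> kC followed by
   a character twist is an automorphism whose u is not injective, which
   contradicts (iv). *)

(** * Hopf automorphisms *)

(** The components r and v are harmless: 1 # h is group-like, so its image is some chi # g. The
    obstacle is u. The map id (x) epsilon is not multiplicative on D(G), because the second tensor
    factor of D(G) conjugates the first, so u is at first only a coalgebra map and no w with u(f) =
    f o w is available. Until p is known to have central values, u and p are therefore handled as
    coefficient matrices in the basis e_c.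

    The twist in vt is forced. An element of Lambda fixes every 1 # g, so if psi = lambda kappa,
    then kappa must agree with psi wherever psi takes a value 1 # g; this happens at u^-1(r(h))^-1 #
    h, with value 1 # vt(h).

    The order of the factors is what fails when G has an abelian factor. A product in Lambda K
    always has a bijective u, whereas in K Lambda the component u acquires a correction a -> a_1
    r(p(a_2)), and the Fourier transform makes this correction kill a character. *)

Section HopfGroup.
Variable k : fieldType.

Lemma hcoord_sum (A : hopfAlgType k) (I : finType) (c : I -> k) (F : I -> A) i :
  hcoord (\sum_j c j *: F j) i = \sum_j c j * hcoord (F j) i.
Proof.
pose L : {linear A -> {ffun hidx -> k^o}} :=
  HB.pack (@hcoord k A) (GRing.isLinear.Build _ _ _ _ _ (@hcoord_linear k A)).
rewrite -[hcoord _]/(L _) linear_sum sum_ffunE.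
by apply: eq_bigr => j _; rewrite linearZ !ffunE.
Qed.

Lemma hcoord_linear_map (A B : hopfAlgType k) (f : A -> B) x i : linear f ->
  hcoord (f x) i = \sum_j hcoord x j * hcoord (f (hbasis j)) i.
Proof.
move=> flin; pose L : {linear A -> B} :=
  HB.pack f (GRing.isLinear.Build _ _ _ _ _ flin).
rewrite -hcoord_sum {1}(hcoordK x) -[f]/(L : A -> B) linear_sum.
by congr (hcoord _ i); apply: eq_bigr => j _; rewrite linearZ.
Qed.

Lemma tensor_mapE (A B : hopfAlgType k) (f : A -> B) t i j :
  tensor_map f t (i, j) = \sum_a \sum_b t (a, b) *
    (hcoord (f (hbasis a)) i * hcoord (f (hbasis b)) j).
Proof.
rewrite /tensor_map sum_ffunE sum_pairE.
by apply: eq_bigr => a _; apply: eq_bigr => b _; rewrite !ffunE.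
Qed.

Lemma tensor_map_comp (A B C : hopfAlgType k) (f : A -> B) (g : B -> C) t :
  linear g -> tensor_map g (tensor_map f t) = tensor_map (g \o f) t.
Proof.
move=> glin; apply/ffunP=> -[i j]; rewrite !tensor_mapE.
under eq_bigr=> a _.
  under eq_bigr=> b _.
    rewrite tensor_mapE mulr_suml.
    under eq_bigr=> c _ do rewrite mulr_suml.
    over.
  rewrite exchange_big /=.
  under eq_bigr=> c _ do rewrite exchange_big /=.
  over.
rewrite exchange_big /=; apply: eq_bigr => c _.
rewrite exchange_big /=; apply: eq_bigr => d _.
rewrite (hcoord_linear_map (f (hbasis c)) i glin).
rewrite (hcoord_linear_map (f (hbasis d)) j glin) big_distrlr /= mulr_sumr.
apply: eq_bigr => a _; rewrite mulr_sumr; apply: eq_bigr => b _.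
ring.
Qed.

Lemma tensor_map_id (A : hopfAlgType k) (f : A -> A) t :
  f =1 id -> tensor_map f t = t.
Proof.
move=> fid; apply/ffunP=> -[i j]; rewrite tensor_mapE.
under eq_bigr=> a _.
  under eq_bigr=> b _ do rewrite !fid !hbasisK !ffunE mulrA.
  rewrite (sum_dltr' j (fun b => t (a, b) * (i == a)%:R)).
  over.
exact: (sum_dltr' i (fun a => t (a, j))).
Qed.

Lemma hopf_morphism_id (A : hopfAlgType k) (f : A -> A) :
  f =1 id -> hopf_morphism f.
Proof.
move=> fid; split=> [a x y||x y|x|x|x]; rewrite ?fid //.
by rewrite tensor_map_id.
Qed.

Lemma hopf_morphism_comp (A B C : hopfAlgType k) (f : A -> B) (g : B -> C) :
  hopf_morphism f -> hopf_morphism g -> hopf_morphism (g \o f).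
Proof.
move=> [fl f1 fM fD fe fS] [gl g1 gM gD ge gS].
split=> [a x y||x y|x|x|x] /=; first by rewrite fl gl.
- by rewrite f1 g1.
- by rewrite fM gM.
- by rewrite gD fD tensor_map_comp.
- by rewrite ge fe.
- by rewrite fS gS.
Qed.

Lemma hopf_morphism_can (A B : hopfAlgType k) (f : A -> B) (g : B -> A) :
  hopf_morphism f -> cancel f g -> cancel g f -> hopf_morphism g.
Proof.
move=> [fl f1 fM fD fe fS] fK gK; have finj := can_inj fK.
have gl : linear g by move=> a x y; apply: finj; rewrite gK fl !gK.
split=> [//||x y|x|x|x]; rewrite -?f1 ?fK //.
- by apply: finj; rewrite gK fM !gK.
- by rewrite -{2}[x]gK fD tensor_map_comp // tensor_map_id.
- by rewrite -{2}[x]gK fe.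
- by apply: finj; rewrite gK fS gK.
Qed.

Section End.
Variable (A : hopfAlgType k).
Implicit Types f g : 'End(A).

Lemma hopf_aut_id : hopf_aut (\1%VF : 'End(A)).
Proof.
split; first by apply: hopf_morphism_id => x; rewrite id_lfunE.
by exists id => x; rewrite id_lfunE.
Qed.

Lemma eq_hopf_aut (f g : A -> A) : f =1 g -> hopf_aut f -> hopf_aut g.
Proof.
move=> fg [fH fB]; split; last exact: eq_bij fB _ fg.
case: fH => fl f1 fM fD fe fS; split=> [a x y||x y|x|x|x]; rewrite -!fg //; first exact: fl.
by rewrite fD; apply: eq_bigr => p _; rewrite !fg.
Qed.

Lemma hopf_aut_comp f g : hopf_aut f -> hopf_aut g -> hopf_aut (f \o g)%VF.
Proof.
move=> [fH fB] [gH gB].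
apply: (@eq_hopf_aut (f \o g)) => [x|]; first by rewrite comp_lfunE.
by split; [exact: hopf_morphism_comp | exact: bij_comp].
Qed.

Lemma hopf_aut_inv f : hopf_aut f ->
  exists g, [/\ hopf_aut g, cancel f g, cancel g f,
    (f \o g = \1)%VF & (g \o f = \1)%VF].
Proof.
move=> [fH [h fK hK]]; have hH := hopf_morphism_can fH fK hK.
pose L : {linear A -> A} :=
  HB.pack h (GRing.isLinear.Build _ _ _ _ _ (hopf_linear hH)).
have gE : linfun L =1 h by move=> x; rewrite lfunE.
exists (linfun L); split.
- by apply: (@eq_hopf_aut h) => [x|]; [rewrite gE | split=> //; exists f].
- by move=> x; rewrite gE fK.
- by move=> x; rewrite gE hK.
- by apply/lfunP=> x; rewrite comp_lfunE gE hK id_lfunE.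
- by apply/lfunP=> x; rewrite comp_lfunE gE fK id_lfunE.
Qed.
End End.
End HopfGroup.

(** * Coordinates in the double *)

Section Double.
Variables (k : fieldType) (gT : finGroupType).
Notation D := (drinfeld k gT).
Notation kG := (grp_alg k gT).
Notation dualG := (fun_alg k gT).
Implicit Types (X Y : D) (a : dualG) (g h x y : gT) (chi s : dualG).

Lemma comulE X p q :
  comul X (p, q) = X (q.1 * p.1, p.2)%g * (p.2 == q.2)%:R.
Proof. by rewrite [comul X]/(drinfeld_comul X) ffunE. Qed.

Lemma mulDE X Y g h :
  (X * Y) (g, h) = \sum_l X (g, l) * Y (g ^ l, l^-1 * h)%g.
Proof. by rewrite [X * Y]/(drinfeld_mul X Y) ffunE. Qed.

Lemma tensE (I J : finType) (f : {ffun I -> k^o}) (f' : {ffun J -> k^o}) i j :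
  tens f f' (i, j) = f i * f' j.
Proof. by rewrite ffunE. Qed.

Lemma id_counitE X g : id_counit X g = \sum_h X (g, h).
Proof.
rewrite ffunE [counit _]/(grp_counit _) /grp_counit.
by apply: eq_bigr => h _; rewrite ffunE.
Qed.

Lemma ev1_idE X h : ev1_id X h = X (1%g, h).
Proof. by rewrite ffunE. Qed.

Lemma smashE a (b : kG) g h : smash a b (g, h) = a g * b h.
Proof. exact: tensE. Qed.

Lemma grp_basisE g h : grp_basis k g h = (h == g)%:R.
Proof. by rewrite ffunE. Qed.

Lemma fun_basisE g h : fun_basis k g h = (h == g)%:R.
Proof. by rewrite ffunE. Qed.

Lemma fun_1E g : (1 : dualG) g = 1. Proof. by rewrite ffunE. Qed.

Lemma fun_mulE a b g : (a * b : dualG) g = a g * b g.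
Proof. by rewrite ffunE. Qed.

Lemma smash_grp_mul a g X x h :
  (smash a (grp_basis k g) * X) (x, h) = a x * X (x ^ g, g^-1 * h)%g.
Proof.
rewrite mulDE -(sum_dlt g (fun l => a x * X (x ^ l, l^-1 * h)%g)).
by apply: eq_bigr => l _; rewrite smashE grp_basisE; ring.
Qed.

Lemma mul_smash_grp a g X x h :
  (X * smash a (grp_basis k g)) (x, h) =
  X (x, h * g^-1)%g * a (x ^ (h * g^-1))%g.
Proof.
rewrite mulDE.
rewrite -(sum_dltr (h * g^-1)%g (fun l => X (x, l) * a (x ^ l)%g)).
apply: eq_bigr => l _; rewrite smashE grp_basisE mulrA.
congr (_ * (nat_of_bool _)%:R); apply/eqP/eqP=> [<-|->]; first by rewrite invMg invgK mulKVg.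
by rewrite invMg invgK mulgKV.
Qed.

Lemma smash_delta (g h : gT) :
  smash (fun_basis k g) (grp_basis k h) = @hbasis k D (g, h).
Proof. exact: smash_basis. Qed.

Lemma smashM a b h :
  smash a (grp_basis k 1) * smash b (grp_basis k h) = smash (a * b) (grp_basis k h).
Proof.
apply/ffunP=> -[x y]; rewrite smash_grp_mul !smashE fun_mulE.
by rewrite conjg1 invg1 mul1g mulrA.
Qed.

Lemma smash_fun_grp a h :
  smash a (grp_basis k 1) * smash 1 (grp_basis k h) = smash a (grp_basis k h).
Proof. by rewrite smashM mulr1. Qed.

Lemma smash_grp_grp g h :
  smash 1 (grp_basis k g) * smash 1 (grp_basis k h) =
  smash (1 : dualG) (grp_basis k (g * h)).
Proof.
apply/ffunP=> -[x y]; rewrite smash_grp_mul !smashE !fun_1E !mul1r !grp_basisE.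
by rewrite -(inj_eq (mulgI g)) mulKVg.
Qed.

Section Characters.

Lemma character_neq0 chi g : is_character chi -> chi g != 0.
Proof.
move=> [c1 cM]; apply/eqP=> c0; have := oner_neq0 k.
by rewrite -c1 -(mulgV g) cM c0 mul0r eqxx.
Qed.

Lemma characterV chi g : is_character chi -> chi g^-1%g = (chi g)^-1.
Proof.
move=> cc; have c0 := character_neq0 g cc; case: cc => c1 cM.
by apply: (mulIf c0); rewrite -cM mulVg c1 mulVf.
Qed.

Lemma characterJ chi g h : is_character chi -> chi (g ^ h)%g = chi g.
Proof.
move=> cc; have c0 := character_neq0 h cc; have cV := characterV h cc.
by case: cc => _ cM; rewrite /conjg !cM cV mulrCA mulVf ?mulr1.
Qed.

Lemma character1 : is_character (1 : dualG).
Proof. by split=> [|g h]; rewrite !fun_1E ?mulr1. Qed.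

Lemma characterMul chi s :
  is_character chi -> is_character s -> is_character (chi * s).
Proof.
move=> [c1 cM] [s1 sM]; split=> [|g h]; rewrite !fun_mulE ?c1 ?s1 ?mulr1 //.
by rewrite cM sM mulrACA.
Qed.

Lemma smash_char_mul chi s g h : is_character s ->
  smash chi (grp_basis k g) * smash s (grp_basis k h) =
  smash (chi * s) (grp_basis k (g * h)).
Proof.
move=> sc; apply/ffunP=> -[x y]; rewrite smash_grp_mul !smashE fun_mulE.
rewrite characterJ // mulrA !grp_basisE -(inj_eq (mulgI g) (_ * _)%g).
by rewrite mulKVg.
Qed.

(** In general [id_counit (X * Y)] mixes the values of Y over conjugates of the first coordinate. A
    character is constant on conjugacy classes, which removes this mixing. *)
Lemma id_counit_mul_char X s h : is_character s ->
  id_counit (X * smash s (grp_basis k h)) = id_counit X * s.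
Proof.
move=> sc; apply/ffunP=> x; rewrite fun_mulE !id_counitE mulr_suml.
rewrite (reindex_inj (mulIg h)); apply: eq_bigr => l _.
by rewrite mul_smash_grp mulgK characterJ.
Qed.

Lemma hom_charJ (r : gT -> dualG) : is_hom_to_characters r ->
  [/\ r 1%g = 1, forall g x, r g^-1%g x = (r g x)^-1 &
   forall g h, r (g ^ h)%g = r g].
Proof.
move=> [rc rM]; have r1: r 1%g = 1.
  apply/ffunP=> x; rewrite fun_1E; apply: (mulfI (character_neq0 x (rc 1%g))).
  by rewrite -fun_mulE -rM mulg1 mulr1.
have rV g x : r g^-1%g x = (r g x)^-1.
  have r0 := character_neq0 x (rc g).
  by apply: (mulIf r0); rewrite -fun_mulE -rM mulVg r1 fun_1E mulVf.
split=> // g h; apply/ffunP=> x; rewrite /conjg !rM !fun_mulE rV mulrCA.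
by rewrite mulVf ?mulr1 ?character_neq0.
Qed.

End Characters.

Definition grouplike X : Prop := comul X = tens X X /\ counit X = 1.

Lemma grouplike_smash chi g : is_character chi ->
  grouplike (smash chi (grp_basis k g)).
Proof.
move=> [c1 cM]; split; last first.
  rewrite [counit _]/(drinfeld_counit _) /drinfeld_counit.
  rewrite -[RHS](sum_dlt g (fun=> 1)); apply: eq_bigr => h _.
  by rewrite smashE c1 mul1r grp_basisE mulr1.
apply/ffunP=> -[[x h] [x' h']]; rewrite comulE [RHS]tensE !smashE cM !grp_basisE /=.
case: (h =P g) => [->|_]; last by rewrite !(mulr0, mul0r).
by rewrite eq_sym; ring.
Qed.

(** In coordinates [comul X = tens X X] says X(xy, h) [h = h'] = X(y, h) X(x, h'). At x = y = 1 this
    makes X(1, g) idempotent, hence 1 for some g; taking y = 1 then empties every column but g, and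
    column g is a character. *)
Lemma grouplikeP X : grouplike X ->
  exists chi g, is_character chi /\ X = smash chi (grp_basis k g).
Proof.
move=> [XD Xe].
have XX x y h h' : X (x * y, h)%g * (h == h')%:R = X (y, h) * X (x, h').
  by have := comulE X (y, h) (x, h'); rewrite XD tensE => ->.
have [g Xg]: exists g, X (1%g, g) != 0.
  apply/existsP; apply: contraT => /existsPn X0.
  have := oner_neq0 k; rewrite -Xe [counit _]/(drinfeld_counit _).
  by rewrite /drinfeld_counit big1 ?eqxx // => h _; apply/eqP/negbNE/X0.
have X1 : X (1%g, g) = 1.
  by apply: (mulfI Xg); rewrite -XX mulg1 eqxx.
have Xh x h : X (x, h) = X (x, h) * (h == g)%:R.
  have := XX x 1%g g h; rewrite mulg1 X1 mul1r (eq_sym g) => <-.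
  by case: (h == g); rewrite ?mulr1 ?mulr0.
exists [ffun x => X (x, g)], g; split.
  split=> [|x y]; rewrite !ffunE ?X1 //.
  by have := XX x y g g; rewrite eqxx mulr1 mulrC.
apply/ffunP=> -[x h]; rewrite smashE !ffunE Xh.
by case: eqP => [->|_]; rewrite ?mulr0.
Qed.

Lemma smash_grp_inj chi s g h : chi 1%g = 1 ->
  smash chi (grp_basis k g) = smash s (grp_basis k h) -> chi = s /\ g = h.
Proof.
move=> c1 /ffunP E; have gh : g = h.
  have := E (1%g, g); rewrite !smashE c1 !grp_basisE eqxx mulr1.
  by case: eqP => // _ /eqP; rewrite mulr0 oner_eq0.
split=> //; apply/ffunP=> x; have := E (x, g).
by rewrite !smashE !grp_basisE -gh eqxx !mulr1.
Qed.

Lemma grouplike_morph (psi : D -> D) X :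
  hopf_morphism psi -> grouplike X -> grouplike (psi X).
Proof.
move=> [pl _ _ pD pe _] [XD Xe]; split; last by rewrite pe.
rewrite pD XD; apply/ffunP=> -[i j]; rewrite tensor_mapE tensE.
rewrite (hcoord_linear_map X i pl : psi X i = _).
rewrite (hcoord_linear_map X j pl : psi X j = _) big_distrlr /=.
apply: eq_bigr => a _; apply: eq_bigr => b _.
by rewrite tensE mulrACA.
Qed.

End Double.

(** * Components of a Hopf endomorphism *)

Section Morphism.
Variables (k : fieldType) (gT : finGroupType).
Notation D := (drinfeld k gT).
Notation kG := (grp_alg k gT).
Notation dualG := (fun_alg k gT).
Implicit Types (X Y : D) (a : dualG) (c g h x y z : gT) (chi s : dualG).

(** Row 1 is inspected because a character takes the value 1 there. *)
Definition group_part X : gT := odflt 1%g [pick h | X (1%g, h) != 0].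

Lemma group_part_smash chi g : chi 1%g = 1 ->
  group_part (smash chi (grp_basis k g)) = g.
Proof.
move=> c1; rewrite /group_part; case: pickP => [h|/(_ g)].
  rewrite smashE c1 mul1r grp_basisE.
  by case: (h =P g) => // _; rewrite eqxx.
by rewrite smashE c1 mul1r grp_basisE eqxx oner_eq0.
Qed.

Lemma id_counit_smash a g : id_counit (smash a (grp_basis k g)) = a.
Proof.
apply/ffunP=> x; rewrite id_counitE.
under eq_bigr=> h _ do rewrite smashE grp_basisE.
exact: (sum_dltr g (fun=> a x)).
Qed.

Lemma ev1_id_smash a g : ev1_id (smash a (grp_basis k g)) = a 1%g *: grp_basis k g.
Proof. by apply/ffunP=> x; rewrite ev1_idE smashE !ffunE. Qed.

Lemma grouplikeE X : grouplike X ->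
  is_character (id_counit X) /\ X = smash (id_counit X) (grp_basis k (group_part X)).
Proof.
move=> /grouplikeP[chi [g [cc ->]]]; rewrite id_counit_smash group_part_smash //.
by case: cc.
Qed.

Lemma linear_sum_delta (psi : D -> D) a (b : kG) p : linear psi ->
  psi (smash a b) p =
  \sum_c \sum_h a c * b h * psi (smash (fun_basis k c) (grp_basis k h)) p.
Proof.
move=> pl; rewrite (@hcoord_linear_map k D D psi (smash a b) p pl : psi _ p = _) sum_pairE.
apply: eq_bigr => c _; apply: eq_bigr => h _.
by rewrite -smash_delta -[X in X * _]/(smash a b (c, h)) smashE.
Qed.

Section Coordinates.
Variable psi : D -> D.
Hypothesis psiH : hopf_morphism psi.

(* ucoef c x and pcoef c h are the coefficients u(e_c)(x) and p(e_c)_h of the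
   components of psi; rpart and vpart are r and v. *)
Definition fimg c : D := psi (smash (fun_basis k c) (grp_basis k 1)).
Definition gimg h : D := psi (smash 1 (grp_basis k h)).
Definition ucoef c x : k := \sum_h fimg c (x, h).
Definition pcoef c h : k := fimg c (1%g, h).
Definition rpart h : dualG := id_counit (gimg h).
Definition vpart h : gT := group_part (gimg h).

Lemma fimg_sum a p : psi (smash a (grp_basis k 1)) p = \sum_c a c * fimg c p.
Proof.
rewrite linear_sum_delta; last exact: hopf_linear psiH.
apply: eq_bigr => c _; under eq_bigr=> h _ do rewrite grp_basisE mulrAC.
exact: (sum_dltr 1%g (fun h => a c * psi (smash _ (grp_basis k h)) p)).
Qed.

Lemma gimgP h : is_character (rpart h) /\
  gimg h = smash (rpart h) (grp_basis k (vpart h)).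
Proof.
apply: grouplikeE; apply: (grouplike_morph psiH).
exact/grouplike_smash/character1.
Qed.

Lemma psi_smash_grp a h : psi (smash a (grp_basis k h)) =
  psi (smash a (grp_basis k 1)) * smash (rpart h) (grp_basis k (vpart h)).
Proof. by rewrite -smash_fun_grp (hopf_M psiH) -(gimgP h).2. Qed.

Lemma gimg_hom : is_hom_to_characters rpart /\ {morph vpart : g h / (g * h)%g}.
Proof.
have gM g h : smash (rpart (g * h)) (grp_basis k (vpart (g * h))) =
    smash (rpart g * rpart h) (grp_basis k (vpart g * vpart h)).
  rewrite -(gimgP _).2 /gimg -smash_grp_grp (hopf_M psiH).
  rewrite -!/(gimg _) {1}(gimgP g).2 {1}(gimgP h).2 smash_char_mul //.
  exact: (gimgP h).1.
have E g h := smash_grp_inj (gimgP (g * h)%g).1.1 (gM g h).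
by split=> [|g h]; [split=> [g|g h]; [exact: (gimgP g).1|] | ]; case: (E g h).
Qed.

(** The co-opposite coproduct sends e_c to the sum of all e_z (x) e_y with y z = c, hence y = c
    z^-1. *)
Lemma comul_fimg c p q :
  comul (fimg c) (p, q) = \sum_z fimg z p * fimg (c * z^-1)%g q.
Proof.
rewrite (hopf_comul psiH) tensor_mapE.
have -> : comul (smash (fun_basis k c) (grp_basis k 1)) =
    drinfeld_comul (drinfeld_basis k (c, 1%g)) by rewrite smash_basis.
rewrite drinfeld_comul_basis.
under eq_bigr=> i _.
  under eq_bigr=> j _ do rewrite sum_ffunE mulr_suml.
  rewrite exchange_big /=.
  over.
rewrite exchange_big /=.
transitivity (\sum_(ab : gT * gT | (ab.1 * ab.2 == c)%g)
    fimg ab.2 p * fimg ab.1 q).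
  apply: eq_bigr => -[y z] _ /=; rewrite /fimg !smash_delta.
  pose F (i : gT * gT) : k := psi (@hbasis k D i) p.
  pose G (i : gT * gT) : k := psi (@hbasis k D i) q.
  rewrite -[RHS](sum_dlt (z, 1%g) (fun i => F i * G (y, 1%g))).
  apply: eq_bigr => i _.
  rewrite -(sum_dlt (y, 1%g) G) !mulr_sumr; apply: eq_bigr => j _.
  by rewrite !ffunE /=; rewrite -[hcoord _ p]/(F i) -[hcoord _ q]/(G j); ring.
rewrite big_mkcond sum_pairE exchange_big /=; apply: eq_bigr => z _.
rewrite -big_mkcond /=; apply: big_pred1 => y /=.
by apply/eqP/eqP=> [<-|->]; rewrite ?mulgK ?mulgKV.
Qed.

Lemma fimgM x y c h h' : fimg c ((y * x)%g, h) * (h == h')%:R =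
  \sum_z fimg z (x, h) * fimg (c * z^-1)%g (y, h').
Proof. by rewrite -comul_fimg comulE. Qed.

(** Apply id (x) epsilon to one leg of the coproduct of psi(e_c # 1) and ev_1 (x) id to the other.
    The two ways to assign the legs give this formula and [fimg_pl]; their agreement is the
    cocommutation of u and p. *)
Lemma fimg_pr x h c :
  fimg c (x, h) = \sum_z ucoef z x * pcoef (c * z^-1)%g h.
Proof.
rewrite -[LHS](sum_dltr h (fun h => fimg c (x, h))).
under eq_bigr=> l _ do rewrite -{1}[x]mul1g fimgM.
by rewrite exchange_big; apply: eq_bigr => z _; rewrite mulr_suml.
Qed.

Lemma fimg_pl x h c :
  fimg c (x, h) = \sum_z ucoef z x * pcoef (z^-1 * c)%g h.
Proof.
rewrite -[LHS](sum_dltr' h (fun=> fimg c (x, h))).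
under eq_bigr=> l _ do rewrite -{1}[x]mulg1 fimgM.
rewrite exchange_big (reindex_inj invg_inj) (reindex_inj (mulgI c^-1%g)).
by apply: eq_bigr => z _; rewrite /= invgK mulKVg invMg invgK -mulr_sumr mulrC.
Qed.

Lemma pcoefM c h h' : pcoef c h * (h == h')%:R =
  \sum_z pcoef z h * pcoef (c * z^-1)%g h'.
Proof. by rewrite /pcoef -{1}[1%g]mulg1 fimgM. Qed.

Lemma ucoefM c x y :
  ucoef c (y * x)%g = \sum_z ucoef z x * ucoef (c * z^-1)%g y.
Proof.
rewrite /ucoef; under eq_bigr=> h _.
  rewrite -(sum_dltr' h (fun=> fimg c ((y * x)%g, h))).
  under eq_bigr=> l _ do rewrite fimgM.
  rewrite exchange_big.
  over.
rewrite exchange_big; apply: eq_bigr => z _; rewrite mulr_suml.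
by apply: eq_bigr => h _; rewrite mulr_sumr.
Qed.

Lemma fimg_orth c c' : fimg c * fimg c' = (c == c')%:R *: fimg c.
Proof.
rewrite /fimg -(hopf_M psiH) smashM.
have -> : fun_basis k c * fun_basis k c' = (c == c')%:R *: fun_basis k c.
  apply/ffunP=> x; rewrite fun_mulE !ffunE.
  case: (x =P c) => [->|_]; last by rewrite mul0r; exact/esym/mulr0.
  by rewrite mul1r; exact/esym/mulr1.
case: eqP => _; first by rewrite !scale1r.
rewrite !scale0r; apply/ffunP=> p; rewrite fimg_sum big1 ?ffunE // => i _.
by rewrite ffunE mul0r.
Qed.

Lemma sum_fimg p : \sum_c fimg c p = (1 : D) p.
Proof.
rewrite -(hopf_1 psiH) -[1 in RHS]/(smash 1 (grp_basis k 1)) fimg_sum.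
by apply: eq_bigr => c _; rewrite fun_1E mul1r.
Qed.

Lemma sum_ucoef x : \sum_c ucoef c x = 1.
Proof.
rewrite /ucoef exchange_big /=; under eq_bigr=> h _ do rewrite sum_fimg.
rewrite -[1]/(smash (1 : dualG) (grp_basis k 1)).
by rewrite -id_counitE id_counit_smash fun_1E.
Qed.

(** Image under psi of (1 # g)(e_c # 1) = (e_(g c g^-1) # 1)(1 # g). The nowhere zero character r(g)
    appears on both sides and cancels. *)
Lemma gimg_fimg g c :
  (forall x, ucoef c (x ^ vpart g)%g = ucoef (c ^ g^-1)%g x) /\
  (forall h, pcoef c ((vpart g)^-1 * h)%g = pcoef (c ^ g^-1)%g (h * (vpart g)^-1)%g).
Proof.
have E : gimg g * fimg c = fimg (c ^ g^-1) * gimg g.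
  rewrite /gimg /fimg -!(hopf_M psiH); congr (psi _); apply/ffunP=> -[y h].
  rewrite smash_grp_mul mul_smash_grp !smashE !fun_1E mul1r mulr1 !fun_basisE.
  rewrite ?grp_basisE; congr ((nat_of_bool _)%:R * (nat_of_bool _)%:R).
    by apply/eqP/eqP=> [<-|->]; rewrite ?conjgK ?conjgKV.
  by apply/eqP/eqP=> [/(canRL (mulKVg g))->|/(canRL (mulgKV g))->]; rewrite ?mulg1 ?mul1g ?mulgV ?mulVg.
have [rc _] := gimgP g; have rH h := character_neq0 h rc.
have F h y : fimg c (y ^ vpart g, (vpart g)^-1 * h)%g =
    fimg (c ^ g^-1)%g (y, h * (vpart g)^-1)%g.
  have := congr1 (fun X : D => X (y, h)) E.
  rewrite (gimgP g).2 smash_grp_mul mul_smash_grp characterJ // mulrC.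
  exact: mulIf.
split=> [x|h]; last by have := F h 1%g; rewrite conj1g.
rewrite /ucoef (reindex_inj (mulgI (vpart g)^-1%g)).
rewrite [RHS](reindex_inj (mulIg (vpart g)^-1%g)).
by apply: eq_bigr.
Qed.

End Coordinates.
End Morphism.

(** * Components of an automorphism *)

Section Automorphism.
Variables (k : fieldType) (gT : finGroupType).
Notation D := (drinfeld k gT).
Notation kG := (grp_alg k gT).
Notation dualG := (fun_alg k gT).
Notation "''Z'" := 'Z([set: gT])%g.
Implicit Types (X Y : D) (a : dualG) (c g h x y z : gT) (chi s : dualG).

Lemma centerE z : reflect (forall x, x ^ z = x)%g (z \in 'Z).
Proof.
rewrite -sub1set subsetI sub1set inE /= sub1set.
apply: (iffP centP) => [cz x|cz x _]; first by rewrite /conjg -(cz x) ?inE ?mulKg.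
by apply: (mulgI z^-1%g); rewrite mulKg; exact/esym/cz.
Qed.

Lemma conjg_fix_sym x y : (x ^ y = x -> y ^ x = y)%g.
Proof. by move=> /conjg_fixP; rewrite commg1_sym => /conjg_fixP. Qed.

(* zpart psi chi is the group-like p(chi). *)
Definition zpart (psi : D -> D) chi : gT :=
  group_part (psi (smash chi (grp_basis k 1))).

(* wpart psi is the endomorphism w of G with u(f) = f o w, once u is known to be
   multiplicative (lemma ucoefE). *)
Definition wpart (psi : D -> D) x : gT :=
  odflt 1%g [pick c | ucoef psi c x != 0].

(** * Centrality of p and multiplicativity of u for an invertible morphism *)

Section Inverse.
Variables psi phi : D -> D.
Hypotheses (psiH : hopf_morphism psi) (phiH : hopf_morphism phi).
Hypotheses (psiK : cancel psi phi) (phiK : cancel phi psi).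

Lemma id_counit_morphism X g : id_counit (phi X) g =
  \sum_x \sum_h X (x, h) * (ucoef phi x g * rpart phi h g).
Proof.
rewrite id_counitE; under eq_bigr=> l _.
  rewrite (@hcoord_linear_map k D D phi X (g, l) (hopf_linear phiH) : phi _ _ = _).
  rewrite sum_pairE.
  over.
rewrite exchange_big /=; apply: eq_bigr => x _.
rewrite exchange_big /=; apply: eq_bigr => h _.
rewrite -mulr_sumr; congr (_ * _).
rewrite -smash_delta -id_counitE (psi_smash_grp phiH).
rewrite id_counit_mul_char ?fun_mulE ?id_counitE //.
exact: (gimgP phiH h).1.
Qed.

(** Here [W y g] is u'(u(e_y)) at g, and [Q z g] is r'(p(e_z)) at g with r' extended linearly to
    kG. *)
Let W y g := \sum_x ucoef psi y x * ucoef phi x g.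
Let Q z g := \sum_h pcoef psi z h * rpart phi h g.

Lemma inverse_coefl c g : (g == c)%:R = \sum_y W y g * Q (y^-1 * c)%g g.
Proof.
rewrite -(fun_basisE k c) -[fun_basis k c in LHS](id_counit_smash _ 1%g).
rewrite -[smash _ _]psiK id_counit_morphism.
under eq_bigr=> x _.
  under eq_bigr=> h _ do rewrite -/(fimg psi c) (fimg_pl psiH) mulr_suml.
  rewrite exchange_big /=.
  over.
rewrite exchange_big /=; apply: eq_bigr => y _.
rewrite /W /Q big_distrlr /=; apply: eq_bigr => x _; apply: eq_bigr => h _.
ring.
Qed.

Lemma inverse_coefr c g : (g == c)%:R = \sum_y W y g * Q (c * y^-1)%g g.
Proof.
rewrite inverse_coefl /W /Q.
under eq_bigr=> y _ do rewrite big_distrlr /=.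
under [RHS]eq_bigr=> y _ do rewrite big_distrlr /=.
rewrite exchange_big [RHS]exchange_big /=; apply: eq_bigr => x _.
rewrite exchange_big [RHS]exchange_big /=; apply: eq_bigr => h _.
transitivity (fimg psi c (x, h) * (ucoef phi x g * rpart phi h g)).
  by rewrite (fimg_pl psiH) mulr_suml; apply: eq_bigr => y _; ring.
by rewrite (fimg_pr psiH) mulr_suml; apply: eq_bigr => y _; ring.
Qed.

(** The diagonal in [pcoefM] identifies the group element summed in Q with the outer h, so
    convolution with Q is just scaling by r'(h). *)
Lemma sum_Q_pcoef c g h :
  \sum_z Q z g * pcoef psi (c * z^-1)%g h = rpart phi h g * pcoef psi c h.
Proof.
rewrite /Q; under eq_bigr=> z _ do rewrite mulr_suml.
rewrite exchange_big /= -[RHS](sum_dltr h (fun l => rpart phi l g * pcoef psi c l)).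
apply: eq_bigr => l _; rewrite -mulrA (pcoefM psiH) mulr_sumr.
by apply: eq_bigr => z _; ring.
Qed.

Lemma sum_Q_pcoefl c g h :
  \sum_z Q z g * pcoef psi (z^-1 * c)%g h = rpart phi h g * pcoef psi c h.
Proof.
rewrite (reindex_inj invg_inj) (reindex_inj (mulIg c^-1%g)) /Q /=.
under eq_bigr=> z _ do rewrite mulr_suml.
rewrite exchange_big /= -[RHS](sum_dltr' h (fun l => rpart phi l g * pcoef psi c h)).
apply: eq_bigr => l _; rewrite -mulrA (pcoefM psiH) mulr_sumr.
by apply: eq_bigr => z _; rewrite invgK mulgKV invMg invgK; ring.
Qed.

(* Insert a = u'u(a_1) r'p(a_2) into the factor compared with g: the r'p part is
   absorbed because the image of p is cocommutative, and what remains is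
   symmetric because u and p cocommute. *)
Lemma pcoef_cop c g h : pcoef psi (g^-1 * c)%g h = pcoef psi (c * g^-1)%g h.
Proof.
pose R := rpart phi h g * \sum_x ucoef phi x g * fimg psi c (x, h).
transitivity R; last symmetry.
  rewrite -(sum_dlt' g (fun d => pcoef psi (d^-1 * c)%g h)).
  under eq_bigr=> d _ do rewrite inverse_coefl mulr_suml.
  rewrite exchange_big /=.
  under eq_bigr=> y _.
    under eq_bigr=> d _ do rewrite -mulrA.
    rewrite -mulr_sumr (reindex_inj (mulgI y)).
    under eq_bigr=> d _ do rewrite mulKg invMg -mulgA.
    rewrite sum_Q_pcoefl /W mulr_suml.
    over.
  rewrite exchange_big /= /R mulr_sumr; apply: eq_bigr => x _.
  by rewrite (fimg_pl psiH) !mulr_sumr; apply: eq_bigr => y _; ring.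
rewrite -(sum_dlt' g (fun d => pcoef psi (c * d^-1)%g h)).
under eq_bigr=> d _ do rewrite inverse_coefr mulr_suml.
rewrite exchange_big /=.
under eq_bigr=> y _.
  under eq_bigr=> d _ do rewrite -mulrA.
  rewrite -mulr_sumr (reindex_inj (mulIg y)).
  under eq_bigr=> d _ do rewrite mulgK invMg mulgA.
  rewrite sum_Q_pcoef /W mulr_suml.
  over.
rewrite exchange_big /= /R mulr_sumr; apply: eq_bigr => x _.
by rewrite (fimg_pr psiH) !mulr_sumr; apply: eq_bigr => y _; ring.
Qed.

Lemma pcoefJ c g h : pcoef psi (c ^ g)%g h = pcoef psi c h.
Proof. by rewrite /conjg pcoef_cop mulgK. Qed.

(** The element chi # 1 is central in D since chi is constant on conjugacy classes. As psi is onto,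
    its image s # z commutes with every e_c # 1, and the coefficient at (c, z) forces c ^ z = c. *)
Lemma char_img chi : is_character chi ->
  [/\ is_character (id_counit (psi (smash chi (grp_basis k 1)))),
    psi (smash chi (grp_basis k 1)) =
      smash (id_counit (psi (smash chi (grp_basis k 1)))) (grp_basis k (zpart psi chi))
    & zpart psi chi \in 'Z].
Proof.
move=> cc; have [|sc E] := @grouplikeE k gT (psi (smash chi (grp_basis k 1))).
  exact/(grouplike_morph psiH)/grouplike_smash.
split=> //; apply/centerE => c.
have cz X : smash chi (grp_basis k 1) * X = X * smash chi (grp_basis k 1).
  apply/ffunP=> -[x h]; rewrite smash_grp_mul mul_smash_grp characterJ //.
  by rewrite conjg1 invg1 mul1g mulg1 mulrC.
have := congr1 psi (cz (phi (smash (fun_basis k c) (grp_basis k 1)))).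
rewrite !(hopf_M psiH) phiK E -/(zpart psi chi).
move=> /(congr1 (fun X : D => X (c, zpart psi chi))).
rewrite smash_grp_mul mul_smash_grp characterJ // !smashE mulVg mulgV.
rewrite !fun_basisE ?grp_basisE !eqxx !mul1r; case: eqP => // _.
rewrite mul0r mulr0 => /esym/eqP.
by rewrite (negPf (character_neq0 c sc)).
Qed.

Lemma zpartM chi s : is_character chi -> is_character s ->
  zpart psi (chi * s) = (zpart psi chi * zpart psi s)%g.
Proof.
move=> cc sc; have [c1 cE _] := char_img cc; have [s1 sE _] := char_img sc.
have [m1 mE _] := char_img (characterMul cc sc).
have E : psi (smash (chi * s) (grp_basis k 1)) =
    psi (smash chi (grp_basis k 1)) * psi (smash s (grp_basis k 1)).
  by rewrite -(hopf_M psiH) smashM.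
have := E; rewrite mE cE sE smash_char_mul //.
by case/(smash_grp_inj m1.1).
Qed.

Lemma gimg_inverse g :
  (zpart psi (rpart phi g) * vpart psi (vpart phi g))%g = g /\
  id_counit (psi (smash (rpart phi g) (grp_basis k 1))) *
    rpart psi (vpart phi g) = 1.
Proof.
have [rc E] := gimgP phiH g; have [sc sE _] := char_img rc.
have := phiK (smash 1 (grp_basis k g)); rewrite -/(gimg phi g) E.
rewrite (psi_smash_grp psiH) sE smash_char_mul; last exact: (gimgP psiH _).1.
have mc := characterMul sc (gimgP psiH (vpart phi g)).1.
by case/(smash_grp_inj mc.1) => ? ?; rewrite id_counit_smash; split.
Qed.

(** Write g as a central element times v(g'). Conjugating h by v(g') amounts to conjugating c by g',
    which [pcoefJ] allows to be undone. *)
Lemma pcoef_class c h g : pcoef psi c (h ^ g)%g = pcoef psi c h.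
Proof.
have [<- _] := gimg_inverse g; set z := zpart _ _; set g' := vpart phi g.
have [_ _ /centerE zc] := char_img (gimgP phiH g).1.
have [_ /(_ (h * vpart psi g')%g)] := gimg_fimg psiH g' c.
by rewrite pcoefJ mulgK conjgM zc.
Qed.

(** Class invariance alone puts p(e_c) in the center of kG, not in the span of the center of G. Used
    in one leg of the diagonal coproduct, it equates p(e_c)_h [h = l ^ l'] with p(e_c)_h [h = l];
    now take l = h. *)
Lemma pcoef_center c h : pcoef psi c h != 0 -> h \in 'Z.
Proof.
move=> ch; apply/centerE => x.
have E l l' : pcoef psi c h * (h == l ^ l')%g%:R = pcoef psi c h * (h == l)%:R.
  by rewrite !(pcoefM psiH); apply: eq_bigr => z _; rewrite pcoef_class.
apply/conjg_fix_sym; have := E h x.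
rewrite eqxx mulr1 eq_sym; case: eqP => // _ /esym/eqP.
by rewrite mulr0 (negPf ch).
Qed.

Lemma ucoef_orth c d x : ucoef psi c x * ucoef psi d x = (c == d)%:R * ucoef psi c x.
Proof.
have := congr1 (fun X => id_counit X x) (fimg_orth psiH c d).
rewrite !id_counitE; under eq_bigr=> h _ do rewrite mulDE.
rewrite exchange_big /= => E.
transitivity (\sum_h fimg psi c (x, h) * ucoef psi d x).
  by rewrite /ucoef mulr_suml.
rewrite /ucoef [RHS]mulr_sumr; transitivity (\sum_h ((c == d)%:R *: fimg psi c) (x, h)).
  rewrite -E; apply: eq_bigr => l _; rewrite -mulr_sumr.
  have [->|/eqP xl] := fimg psi c (x, l) =P 0; first by rewrite !mul0r.
  (* By [fimg_pl] the second coordinate of the support comes from p, hence is central, and the twist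
     [x ^ l] drops out of the product. *)
  have /centerE lc : l \in 'Z.
    apply: contraNT xl => lc; rewrite (fimg_pl psiH) big1 // => z _.
    have [->|/pcoef_center] := eqVneq (pcoef psi (z^-1 * c)%g l) 0; last first.
      by rewrite (negPf lc).
    by rewrite mulr0.
  congr (_ * _); rewrite [LHS](reindex_inj (mulgI l^-1%g)).
  by apply: eq_bigr => h _; rewrite lc.
by apply: eq_bigr => h _; rewrite ffunE.
Qed.

(** For fixed x the scalars u(e_c)(x) are pairwise orthogonal and add up to 1 in a field, so exactly
    one of them is 1 and the others vanish. *)
Lemma ucoefE c x : ucoef psi c x = (c == wpart psi x)%:R.
Proof.
have [d dx]: exists d, ucoef psi d x != 0.
  apply/existsP; apply: contraT => /existsPn u0.
  have := oner_neq0 k; rewrite -(sum_ucoef psiH x).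
  by rewrite big1 ?eqxx // => d _; apply/eqP/negbNE/u0.
have u0 e : e != d -> ucoef psi e x = 0.
  move=> ed; apply: (mulfI dx); rewrite ucoef_orth eq_sym (negPf ed).
  by rewrite mul0r mulr0.
have u1 : ucoef psi d x = 1.
  by rewrite -(sum_ucoef psiH x) (bigD1 d) //= big1 ?addr0.
have -> : wpart psi x = d.
  rewrite /wpart; case: pickP => [e|/(_ d)]; last by rewrite dx.
  by apply: contraNeq => /u0->.
by case: eqP => [->|/eqP/u0].
Qed.

Lemma wpartM : {morph wpart psi : x y / (x * y)%g}.
Proof.
move=> x y; have := ucoefM psiH (wpart psi (x * y)) y x.
rewrite ucoefE eqxx; under eq_bigr=> z _ do rewrite !ucoefE.
rewrite (sum_dlt (wpart psi y) (fun z => (_ * z^-1 == wpart psi x)%g%:R)).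
by case: eqP => [<- _|_ /eqP]; [rewrite mulgKV | rewrite oner_eq0].
Qed.

Lemma fimgE c x h : fimg psi c (x, h) = pcoef psi ((wpart psi x)^-1 * c)%g h.
Proof.
rewrite (fimg_pl psiH); under eq_bigr=> z _ do rewrite ucoefE.
exact: (sum_dlt (wpart psi x) (fun z => pcoef psi (z^-1 * c)%g h)).
Qed.

Lemma id_counit_img a x : id_counit (psi (smash a (grp_basis k 1))) x = a (wpart psi x).
Proof.
rewrite id_counitE; under eq_bigr=> h _ do rewrite (fimg_sum psiH).
rewrite exchange_big /= -[RHS](sum_dltr (wpart psi x) a).
by apply: eq_bigr => c _; rewrite -mulr_sumr -ucoefE.
Qed.

Lemma wpartJ x g : wpart psi (x ^ vpart psi g)%g = (wpart psi x ^ g)%g.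
Proof.
have [/(_ x)] := gimg_fimg psiH g (wpart psi (x ^ vpart psi g)).
rewrite !ucoefE eqxx; case: eqP => [<-|_ /eqP]; last by rewrite oner_eq0.
by rewrite conjgKV.
Qed.

End Inverse.

Section Inverse2.
Variables psi phi : D -> D.
Hypotheses (psiH : hopf_morphism psi) (phiH : hopf_morphism phi).
Hypotheses (psiK : cancel psi phi) (phiK : cancel phi psi).

(** Put e = w(w'(g)). The u-component of [phi \o psi] = id reads [g = e y] = r'(p(e_y))(g), and the
    right side does not change when y is conjugated; apply this to y = e^-1 g. *)
Lemma wpart_inverse g : ((wpart psi (wpart phi g))^-1 * g)%g \in 'Z.
Proof.
set e := wpart psi _.
have E c : (g == c)%:R = \sum_h pcoef psi (e^-1 * c)%g h * rpart phi h g.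
  rewrite (inverse_coefl psiH phiH psiK).
  rewrite -[RHS](sum_dlt e (fun y => \sum_h pcoef psi (y^-1 * c)%g h * rpart phi h g)).
  apply: eq_bigr => y _; congr (_ * _).
  under eq_bigr=> x _.
    rewrite (ucoefE psiH phiH psiK phiK) (ucoefE phiH psiH phiK psiK) mulrC.
    over.
  exact: (sum_dlt (wpart phi g) (fun x => (y == wpart psi x)%:R)).
apply/centerE => x; apply/conjg_fix_sym.
have := E (e * ((e^-1 * g) ^ x))%g; rewrite mulKg.
under eq_bigr=> h _ do rewrite (pcoefJ psiH phiH psiK).
rewrite -E eqxx; case: eqP => [ge _|_ /eqP]; first by rewrite {2}ge mulKg.
by rewrite eq_sym oner_eq0.
Qed.

End Inverse2.
End Automorphism.

(** * Central endomorphisms and cyclic direct factors *)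

(** Pigeonhole: one more iterate is considered than there are self-maps of T, which gives a
    preperiod i and a period j - i. *)
Lemma iter_idempotent (T : finType) (E : T -> T) :
  exists2 n, (0 < n)%N & iter n E \o iter n E =1 iter n E.
Proof.
pose F (i : 'I_#|{ffun T -> T}|.+1) := [ffun x => iter i E x].
have /injectivePn[i [j ij eF]]: ~~ injectiveb F.
  by apply/injectiveP=> /leq_card; rewrite card_ord ltnn.
wlog lt_ij : i j ij eF / (i < j)%N.
  move=> H; have := ij; rewrite neq_ltn => /orP[|] lt; first exact: (H i j).
  by apply: (H j i) => //; rewrite eq_sym.
have per m (x : T) : (i <= m)%N -> iter (m + (j - i)) E x = iter m E x.
  move=> im; rewrite -(subnK im) -addnA subnKC 1?ltnW // !iterD.
  by have := congr1 (fun f : {ffun _} => f x) eF; rewrite !ffunE => ->.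
have perM q m (x : T) : (i <= m)%N -> iter (m + q * (j - i)) E x = iter m E x.
  move=> im; elim: q => [|q IH]; first by rewrite addn0.
  by rewrite mulSn addnCA addnC per ?IH // ?(leq_trans im) ?leq_addr.
(* A multiple of the period that is at least the preperiod; the factor [i.+1] instead of i keeps it
   positive when i = 0. *)
exists (i.+1 * (j - i))%N; first by rewrite muln_gt0 subn_gt0.
move=> x /=; rewrite -iterD perM //.
by rewrite (leq_trans (leqnSn i)) // leq_pmulr // subn_gt0.
Qed.

Section CentralEndomorphism.
Variable gT : finGroupType.
Implicit Types x y : gT.

(* Fitting's decomposition: an idempotent power of E splits the group as the
   direct product of its kernel, which is central, and its image. *)
Lemma central_endo_inj (E : gT -> gT) : purely_nonabelian gT ->
  {morph E : x y / (x * y)%g} ->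
  (forall x, (E x)^-1 * x \in 'Z([set: gT]))%g -> injective E.
Proof.
move=> pnG EM Ez; have [n n0 idem] := iter_idempotent E.
pose e := iter n E.
have eM : {morph e : x y / (x * y)%g}.
  by rewrite /e; elim: (n) => [|m IH] x y //=; rewrite IH EM.
have e1 : e 1%g = 1%g by apply: (mulgI (e 1%g)); rewrite -eM !mulg1.
have ez x : ((e x)^-1 * x)%g \in 'Z([set: gT])%g.
  rewrite /e; elim: (n) => [|m IH] /=; first by rewrite mulVg group1.
  have -> : ((E (iter m E x))^-1 * x = (E (iter m E x))^-1 * iter m E x *
     ((iter m E x)^-1 * x))%g by rewrite mulgA mulgK.
  by rewrite groupM.
have ee x : e (e x) = e x by exact: idem.
have gA : group_set [set x | e x == 1%g].
  apply/group_setP; split=> [|x y]; rewrite !inE ?e1 // eM.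
  by move=> /eqP-> /eqP->; rewrite mulg1.
have gB : group_set [set x | e x == x].
  apply/group_setP; split=> [|x y]; rewrite !inE ?e1 // eM.
  by move=> /eqP-> /eqP->.
pose A := group gA; pose B := group gB.
have AZ : A \subset 'Z([set: gT])%g.
  apply/subsetP=> x; rewrite inE => /eqP ex; have := ez x.
  by rewrite ex invg1 mul1g.
have AC : A \subset 'C([set: gT])%g by apply: subset_trans AZ (subsetIr _ _).
have dAB : (A \x B)%g = [set: gT].
  rewrite dprodE; last 2 first.
  - by rewrite centsC (subset_trans AC) ?centS ?subsetT.
  - apply/trivgP/subsetP=> x; rewrite !inE => /andP[/eqP ex].
    by rewrite ex eq_sym.
  apply/setP=> x; rewrite inE; apply/mulsgP.
  exists (x * (e x)^-1)%g (e x); last by rewrite mulgKV.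
    rewrite inE eM -{1}ee; apply/eqP; apply: (mulIg (e (e x))).
    by rewrite -mulgA -eM mulVg e1 mulg1 mul1g ee.
  by rewrite inE ee.
have A1 : A :=: 1%g.
  apply: (pnG A B dAB); apply: subset_trans AC (centS (subsetT _)).
have E1 : E 1%g = 1%g by apply: (mulgI (E 1%g)); rewrite -EM !mulg1.
move=> x y Exy; apply/eqP; rewrite eq_mulgV1; apply/eqP/set1P.
have <- : A = [set 1%g] :> {set gT} by rewrite A1.
have Exy1 : E (x * y^-1)%g = 1%g.
  by apply: (mulIg (E y)); rewrite -EM mulgKV mul1g.
(* As n > 0, an innermost E can be split off e, so the kernel of E lies in A. *)
rewrite inE /e -(prednK n0) iterSr Exy1.
by elim: n.-1 => //= m /eqP->; rewrite E1.
Qed.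

End CentralEndomorphism.

(** Since n is invertible in k, the polynomial X^n - 1 is separable; its n distinct roots must
    include a primitive one. *)
Lemma closed_prim_root (k : closedFieldType) n :
  (n%:R != 0 :> k) -> {z : k | n.-primitive_root z}.
Proof.
move=> n0; have n_gt0 : (0 < n)%N by rewrite lt0n; apply: contraNneq n0 => ->.
pose p : {poly k} := 'X^n - 1.
have [r Dp] := closed_field_poly_normal p.
have sz : size p = n.+1 by rewrite size_XnsubC.
rewrite (monicP _) ?monicXnsubC // scale1r in Dp.
apply/sigW; have rn1 : all n.-unity_root r.
  by apply/allP=> z; rewrite -root_prod_XsubC -Dp.
have sr : (n < (size r).+1)%N by rewrite -(size_prod_XsubC r id) -Dp sz.
suffices ur : uniq r by have /hasP[z] := has_prim_root n_gt0 rn1 ur sr; exists z.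
rewrite -separable_prod_XsubC -Dp separable_Xn_sub_1 //.
Qed.

Lemma abelian_cyclic_factor (gT : finGroupType) (A B : {group gT}) :
  (A \x B)%g = [set: gT] -> abelian A -> A :!=: 1%g ->
  exists (x : gT) (H : {group gT}), (1 < #[x]%g)%N /\ (<[x]> \x H)%g = [set: gT].
Proof.
move=> dAB abA A1; have [b defA ord_b] := abelian_structure abA.
case: b defA ord_b => [|x b] defA ord_b.
  by move: A1; rewrite -defA big_nil eqxx.
have := abelian_type_gt1 A; rewrite -ord_b /= => /andP[x1 _].
move: dAB; rewrite -defA big_cons -dprodA => dG.
by have [[_ H _ eH] _ _ _] := dprodP dG; exists x, H; rewrite -eH.
Qed.

(* The coefficients P c h of a morphism from (k^G)^cop to kG, e_c |-> sum_h P c h h,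
   supported on pairs of central elements. *)
Record central_kernel (k : fieldType) (gT : finGroupType) (P : gT -> gT -> k) :
    Prop := CentralKernel {
  kernel_comul : forall c h h',
    \sum_z P z h * P (c * z^-1)%g h' = P c h * (h == h')%:R;
  kernel_mul : forall c c' h,
    \sum_l P c l * P c' (l^-1 * h)%g = (c == c')%:R * P c h;
  kernel_1 : forall h, \sum_c P c h = (h == 1%g)%:R;
  kernel_counit : forall c, \sum_h P c h = (c == 1%g)%:R;
  kernel_antipode : forall c h, P c^-1%g h^-1%g = P c h;
  kernel_center : forall c h, P c h != 0 ->
    (c \in 'Z([set: gT]))%g /\ (h \in 'Z([set: gT]))%g
}.

(** * The Fourier transform of a cyclic direct factor *)

Section Fourier.
Variables (k : closedFieldType) (gT : finGroupType) (x : gT) (H : {group gT}).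
Hypothesis char0 : [pchar k] =i pred0.
Hypothesis dG : (<[x]> \x H)%g = [set: gT].
Let n := #[x]%g.

(** The discrete logarithm of the projection to the cyclic factor; it is additive because x is
    central in G. *)
Lemma cyclic_factor_log : exists ell : gT -> nat,
  (forall g h, ell (g * h)%g = (ell g + ell h)%N %[mod n]) /\
  (forall i, ell (x ^+ i)%g = i %[mod n]).
Proof.
have [_ defG cxH tiH] := dprodP dG.
(* [n.-1.+1] equals n, in the shape that [ord0] requires. The default is never taken, by [ellP]. *)
pose ell g : nat := odflt ord0 [pick i : 'I_n.-1.+1 | (x ^+ i)^-1 * g \in H]%g.
have ellP g : ((x ^+ ell g)^-1 * g)%g \in H.
  rewrite /ell; case: pickP => //= no.
  have : g \in (<[x]> * H)%g by rewrite defG inE.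
  case/mulsgP=> _ h /cycleP[i ->] Hh eg.
  have lt : (i %% n < n.-1.+1)%N by rewrite prednK ?order_gt0 // ltn_pmod ?order_gt0.
  by have := no (Ordinal lt); rewrite /= expg_mod_order eg mulKg Hh.
have ellE g i : ((x ^+ i)^-1 * g)%g \in H -> ell g = i %[mod n].
  move=> Hi; apply/eqP; rewrite -eq_expg_mod_order eq_mulVg1.
  have : ((x ^+ ell g)^-1 * x ^+ i)%g \in (<[x]> :&: H)%g.
    rewrite inE groupM ?groupV ?mem_cycle //=.
    have := groupM (ellP g) (groupVr Hi); rewrite invMg invgK mulgA.
    by rewrite mulgK.
  by rewrite tiH => /set1P->.
exists ell; split=> [g h|i]; last by apply: ellE; rewrite mulVg group1.
apply: ellE; have := groupM (ellP g) (ellP h).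
have -> : ((x ^+ (ell g + ell h))^-1 * (g * h) =
    (x ^+ ell g)^-1 * g * ((x ^+ ell h)^-1 * h))%g; last by [].
have cx y : commute x y.
  have /mulsgP[y1 y2 y1x y2H ->] : y \in (<[x]> * H)%g by rewrite defG inE.
  apply: commuteM; first by case/cycleP: y1x => i ->; exact: commuteX.
  exact/commute_sym/(centP (subsetP cxH _ y2H))/cycle_id.
have cX i y : commute (x ^+ i)^-1%g y.
  by apply/commute_sym/commuteV/commute_sym; exact/commute_sym/commuteX/commute_sym/cx.
by rewrite addnC expgD invMg -!mulgA (mulgA g) -(cX _ g) !mulgA.
Qed.

(** With z a primitive n-th root of unity, beta(h)(g) = z^(ell(h) ell(g)) is a symmetric
    bicharacter, nondegenerate on C = <[x]>. P is the transform k^C -> kC that sends e_c to n^-1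
    times the sum of beta(h)(c)^-1 h over h in C. The last clause says that it turns the character
    beta(x) into the group element x. *)
Lemma fourier_kernel : (1 < n)%N -> exists (beta : gT -> fun_alg k gT) P,
  [/\ is_hom_to_characters beta, central_kernel P, beta x != 1 &
     forall h, \sum_c P c h * beta x c = (h == x)%:R].
Proof.
move=> n1; have [ell [ellM ellX]] := cyclic_factor_log.
have n0 : n%:R != 0 :> k by rewrite (proj1 (pcharf0P k) char0) -lt0n order_gt0.
have [z zP] := closed_prim_root n0.
pose beta (h : gT) : fun_alg k gT := [ffun g => z ^+ (ell h * ell g)].
have bE h g : beta h g = z ^+ (ell h * ell g) by rewrite ffunE.
have bC h g : beta h g = beta g h by rewrite !bE mulnC.
have zmod i j : i = j %[mod n] -> z ^+ i = z ^+ j.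
  by move=> ij; apply/eqP; rewrite (eq_prim_root_expr zP); apply/eqP.
have bMr h g g' : beta h (g * g')%g = beta h g * beta h g'.
  by rewrite !bE -exprD -mulnDr; apply: zmod; rewrite -modnMmr ellM modnMmr.
have bMl h h' g : beta (h * h')%g g = beta h g * beta h' g.
  by rewrite !(bC _ g) bMr.
have b1 h : beta h 1%g = 1.
  have -> : 1 = z ^+ 0 by []; rewrite bE; apply: zmod.
  by rewrite -modnMmr -(expg0 x) ellX mod0n muln0 mod0n.
have bhom : is_hom_to_characters beta.
  split=> [h|h h']; first by split; [exact: b1 | exact: bMr].
  by apply/ffunP=> g; rewrite fun_mulE bMl.
have bVr h g : beta h g^-1%g = (beta h g)^-1 by apply: characterV; case: bhom.
have [_ bVl _] := hom_charJ bhom.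
have b0 h g : beta h g != 0 by apply: character_neq0; case: bhom.
pose C := <[x]>%g.
have CZ c : c \in C -> c \in 'Z([set: gT])%g.
  have [_ defG cxH _] := dprodP dG; move=> Cc; apply/centerP; split=> [|y _]; first by rewrite inE.
  have /mulsgP[y1 y2 y1x y2H ->] : y \in (<[x]> * H)%g by rewrite defG inE.
  apply: commuteM; first exact: (centP (subsetP (cycle_abelian x) _ Cc)).
  exact/commute_sym/(centP (subsetP cxH _ y2H)).
(* Orthogonality of characters: for d != 1, translation by x multiplies the sum by beta(d)(x), which
   is not 1. *)
have orth d : d \in C -> \sum_(c in C) beta d c = n%:R * (d == 1%g)%:R.
  have [->|d1] := eqVneq d 1%g.
    move=> _; under eq_bigr=> c _ do rewrite bC b1.
    by rewrite sumr_const mulr1.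
  case/cycleP=> i di; have bx : beta d x != 1.
    rewrite bE -(expg1 x) -(prim_expr_mod zP) -modnMmr ellX modnMmr muln1.
    have -> : (ell d %% n)%N = (i %% n)%N by rewrite di ellX.
    rewrite -(expr0 z) (eq_prim_root_expr zP) mod0n modn_mod -/(dvdn n i).
    by rewrite order_dvdn -di.
  rewrite mulr0; set S := \sum_(c in C) _.
  have : S = beta d x * S.
    rewrite {1}/S (reindex_inj (mulgI x)) mulr_sumr.
    by apply: eq_big => [c|c _]; rewrite ?groupMl ?cycle_id ?bMr.
  move/eqP; rewrite -subr_eq0 -{1}[S]mul1r -mulrBl mulf_eq0 subr_eq0 eq_sym.
  by rewrite (negPf bx) => /eqP.
pose P c h : k := ((c \in C) && (h \in C))%:R * (n%:R^-1 * beta h c^-1%g).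
(* Symmetry of P lets [kernel_mul] and [kernel_1] follow from the coproduct and counit
   identities. *)
have PC c h : P c h = P h c.
  by rewrite /P andbC bVr bC -bVr.
have Pcomul c h h' : \sum_y P y h * P (c * y^-1)%g h' = P c h * (h == h')%:R.
  rewrite /P; have [Ch|Ch] := boolP (h \in C); last first.
    by rewrite andbF !mul0r big1 // => y _; rewrite andbF !mul0r.
  have [Ch'|Ch'] := boolP (h' \in C); last first.
    rewrite big1 => [|y _]; last by rewrite andbF mul0r mulr0.
    by case: eqP => [E|_]; [rewrite -E Ch in Ch' | rewrite mulr0].
  have [Cc|Cc] := boolP (c \in C); last first.
    rewrite !mul0r big1 // => y _; rewrite !andbT.
    have [Cy|_] := boolP (y \in C); last by rewrite !mul0r.
    by rewrite groupMr ?groupV // (negPf Cc) !mul0r mulr0.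
  transitivity (\sum_(y in C) n%:R^-1 * n%:R^-1 * beta h' c^-1%g * beta (h' * h^-1)%g y).
    rewrite [RHS]big_mkcond; apply: eq_bigr => y _; rewrite !andbT.
    case: ifP => Cy; last by rewrite !mul0r.
    rewrite groupM ?groupV // !mul1r invMg invgK !bMr bMl bVl !bVr.
    ring.
  rewrite -mulr_sumr orth ?groupM ?groupV // -eq_mulgV1 (eq_sym h').
  case: (h =P h') => [->|_]; last by rewrite !mulr0.
  by rewrite !mulr1 mul1r mulrAC mulfVK.
have Pcounit c : \sum_h P c h = (c == 1%g)%:R.
  rewrite /P; have [Cc|Cc] := boolP (c \in C); last first.
    rewrite big1 => [|h _]; last by rewrite mul0r.
    by case: eqP => // E; rewrite E group1 in Cc.
  transitivity (\sum_(h in C) n%:R^-1 * beta c^-1%g h).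
    rewrite [RHS]big_mkcond; apply: eq_bigr => h _.
    by case: ifP => _; rewrite ?mul0r // mul1r bC.
  by rewrite -mulr_sumr orth ?groupV // eq_invg1 mulrA mulVf // mul1r.
exists beta, P; split=> [//||//|].
- split=> [//|c c' h|h|//|c h|c h].
  + under eq_bigr=> l _.
      rewrite (PC c) (PC c').
      have -> : P l c * P (l^-1 * h)%g c' = P l c * P (h * l^-1)%g c'.
        rewrite /P; have [/CZ Zl|_] := boolP (l \in C); last by rewrite !mul0r.
        by congr (_ * (_ * _)); have /centerP[_ /(_ h)->] := groupVr Zl; rewrite ?inE.
      over.
    by rewrite Pcomul mulrC (PC h).
  + by under eq_bigr=> c _ do rewrite PC; exact: Pcounit.
  + by rewrite /P !groupV bVl -bVr invgK.
  + rewrite /P; case: (boolP (c \in C)) => Cc; last by rewrite mul0r eqxx.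
    by case: (boolP (h \in C)) => Ch; [move=> _; split; exact: CZ | rewrite mul0r eqxx].
- by apply/eqP=> /ffunP/(_ x)/eqP; rewrite bE fun_1E -(expr0 z) (eq_prim_root_expr zP)
    mod0n -modnMm -(expg1 x) ellX modnMm muln1 modn_small.
- move=> h; rewrite /P; have [Ch|Ch] := boolP (h \in C); last first.
    rewrite big1 => [|c _]; last by rewrite andbF !mul0r.
    by case: eqP => // E; rewrite E cycle_id in Ch.
  transitivity (\sum_(c in C) n%:R^-1 * beta (x * h^-1)%g c).
    rewrite [RHS]big_mkcond; apply: eq_bigr => c _; rewrite andbT.
    case: ifP => Cc; last by rewrite !mul0r.
    by rewrite mul1r bMl bVl bVr; ring.
  rewrite -mulr_sumr orth ?groupM ?groupV ?cycle_id // -eq_mulgV1 (eq_sym h).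
  by rewrite mulrA mulVf // mul1r.
Qed.
End Fourier.

(** * Automorphisms with trivial p *)

Section KMaps.
Variables (k : fieldType) (gT : finGroupType).
Notation D := (drinfeld k gT).
Notation kG := (grp_alg k gT).
Notation dualG := (fun_alg k gT).
Notation "''Z'" := 'Z([set: gT])%g.
Notation AutG := (Aut [set: gT])%g.
Implicit Types (X Y : D) (a : dualG) (c g h x y z : gT) (w v : {perm gT})
  (r : gT -> dualG).

Lemma sum_unit (V : nmodType) (F : unit -> V) : \sum_u F u = F tt.
Proof. by rewrite (big_pred1 tt) // => -[]. Qed.

(** Meant for both families of maps below: U is [unit] for [kmap], which has one term per
    coordinate, and [gT * gT] for [lam]. *)
Lemma tensor_map_kernel (U : finType) (psi : D -> D)
    (m : U -> gT * gT -> k) (f : U -> gT * gT -> gT * gT) t p q :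
  (forall X p, psi X p = \sum_u m u p * X (f u p)) ->
  tensor_map psi t (p, q) =
  \sum_u \sum_u' m u p * m u' q * t (f u p, f u' q).
Proof.
move=> psiE; rewrite tensor_mapE.
transitivity (\sum_i \sum_j \sum_u \sum_u'
   (i == f u p)%:R * ((j == f u' q)%:R * (m u p * m u' q * t (i, j)))).
  apply: eq_bigr => i _; apply: eq_bigr => j _.
  rewrite -[hcoord _ p]/(psi _ p) -[hcoord _ q]/(psi _ q) !psiE big_distrlr.
  rewrite mulr_sumr; apply: eq_bigr => u _; rewrite mulr_sumr; apply: eq_bigr => u' _.
  rewrite !ffunE /= (eq_sym i) (eq_sym j); ring.
under eq_bigr=> i _ do rewrite exchange_big /=.
rewrite exchange_big /=; apply: eq_bigr => u _.
under eq_bigr=> i _ do rewrite exchange_big /=.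
rewrite exchange_big /=; apply: eq_bigr => u' _.
under eq_bigr=> i _ do rewrite -mulr_sumr.
rewrite (sum_dlt (f u p)
  (fun i => \sum_j (j == f u' q)%:R * (m u p * m u' q * t (i, j)))).
exact: (sum_dlt (f u' q) (fun j => m u p * m u' q * t (f u p, j))).
Qed.

Lemma lfun_basis_ext (psi phi : 'End(D)) :
  (forall g h, psi (smash (fun_basis k g) (grp_basis k h)) =
               phi (smash (fun_basis k g) (grp_basis k h))) -> psi = phi.
Proof.
move=> E; apply/lfunP=> X; rewrite (@hcoordK k D X) !linear_sum.
apply: eq_bigr => -[g h] _; rewrite !linearZ; congr (_ *: _).
by have := E g h; rewrite smash_delta.
Qed.

Lemma AutG_M w : w \in AutG -> {morph w : x y / (x * y)%g}.
Proof. by move=> wA x y; rewrite (morphicP (Aut_morphic wA)) ?inE. Qed.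

Lemma morph1g (f : gT -> gT) : {morph f : x y / (x * y)%g} -> f 1%g = 1%g.
Proof. by move=> fM; apply: (mulgI (f 1%g)); rewrite -fM !mulg1. Qed.

Lemma morphVg (f : gT -> gT) x : {morph f : x y / (x * y)%g} -> f x^-1%g = (f x)^-1%g.
Proof. by move=> fM; apply: (mulgI (f x)); rewrite -fM !mulgV morph1g. Qed.

Lemma morphJg (f : gT -> gT) x y : {morph f : x y / (x * y)%g} ->
  f (x ^ y)%g = (f x ^ f y)%g.
Proof. by move=> fM; rewrite /conjg !fM morphVg. Qed.

Lemma AutG_perm (f : gT -> gT) (finj : injective f) :
  {morph f : x y / (x * y)%g} -> perm finj \in AutG.
Proof.
move=> fM; rewrite inE; apply/andP; split.
  by apply/subsetP=> x _; rewrite inE.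
by apply/morphicP=> x y _ _; rewrite !permE.
Qed.

Lemma AutG_center w z : w \in AutG -> z \in 'Z -> w z \in 'Z.
Proof.
move=> wA /centerE zc; apply/centerE => x; rewrite -(permKV w x).
by rewrite -(morphJg _ _ (AutG_M wA)) zc.
Qed.

(* kmap w v r is the map e_g # h |-> r(h) e_(w g) # v(h). *)
Definition kmap_fun w v r X : D :=
  [ffun p => r (v^-1%g p.2) p.1 * X (w^-1%g p.1, v^-1%g p.2)].

Lemma kmap_funE w v r X g h :
  kmap_fun w v r X (g, h) = r (v^-1%g h) g * X (w^-1%g g, v^-1%g h).
Proof. by rewrite ffunE. Qed.

Fact kmap_fun_linear w v r : linear (kmap_fun w v r).
Proof.
move=> a X Y; apply/ffunP=> -[g h]; rewrite !ffunE /= mulrDr; congr (_ + _).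
exact: mulrCA.
Qed.

HB.instance Definition _ w v r :=
  GRing.isLinear.Build k D D *:%R (kmap_fun w v r) (kmap_fun_linear w v r).

Definition kmap w v r : 'End(D) := linfun (kmap_fun w v r).

Lemma kmapE w v r X g h :
  kmap w v r X (g, h) = r (v^-1%g h) g * X (w^-1%g g, v^-1%g h).
Proof. by rewrite lfunE kmap_funE. Qed.

Lemma kmap_smash w v r a h : kmap w v r (smash a (grp_basis k h)) =
  smash (r h * [ffun x => a (w^-1%g x)]) (grp_basis k (v h)).
Proof.
apply/ffunP=> -[x y]; rewrite kmapE !smashE fun_mulE ffunE !grp_basisE.
rewrite -(inj_eq (@perm_inj _ v)) permKV.
by rewrite ffunE mulrA; case: (y =P v h) => [->|_]; rewrite ?permK ?mulr0.
Qed.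

Definition kdata w v r := [/\ w \in AutG, v \in AutG,
  forall g, (w^-1%g (v g) * g^-1)%g \in 'Z & is_hom_to_characters r].

(** The elements w^-1(v(h)) and h differ by a central factor, so they conjugate alike. This is what
    makes [kmap] respect the twisted product of D. *)
Lemma kdataJ w v r x h : kdata w v r -> (w^-1 (x ^ v h) = w^-1 x ^ h)%g.
Proof.
move=> [wA _ /(_ h)/centerE c _]; rewrite (morphJg _ _ (AutG_M (groupVr wA))).
by rewrite -[in RHS](c (w^-1%g x)) -conjgM mulgKV.
Qed.

Lemma kmap_hopf w v r : kdata w v r -> hopf_morphism (kmap w v r).
Proof.
move=> kd; have J x h := kdataJ x h kd; case: kd => wA vA _ rH.
have [wM vM] := (AutG_M (groupVr wA), AutG_M (groupVr vA)).
have [r1 rV rJ] := hom_charJ rH; have [rc rM] := rH.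
split=> [a X Y||X Y|X|X|X]; first exact: linearP.
- rewrite -[1]/(smash 1 (grp_basis k 1)) kmap_smash (morph1g (AutG_M vA)).
  by congr (smash _ _); apply/ffunP=> x; rewrite r1 fun_mulE !ffunE mulr1.
- apply/ffunP=> -[x g]; rewrite kmapE !mulDE mulr_sumr.
  rewrite [RHS](reindex_inj (@perm_inj _ v)); apply: eq_bigr => l _.
  rewrite !kmapE J vM (morphVg _ vM) permK !rM !fun_mulE rV.
  have := character_neq0 x (rc l); have /characterJ E := rc l.
  rewrite (characterJ _ _ (rc (v^-1 g)%g)) (characterJ _ _ (rc l)).
  move: (r l x) (r (v^-1 g)%g x) => s t s0; by field.
- apply/ffunP=> -[[x h] [y h']].
  rewrite (@tensor_map_kernel unit _ (fun _ p => r (v^-1%g p.2) p.1)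
    (fun _ p => (w^-1%g p.1, v^-1%g p.2))); last first.
    by move=> X' [x' y']; rewrite kmapE sum_unit.
  rewrite !sum_unit /=.
  rewrite !comulE kmapE wM (inj_eq perm_inj) /=.
  have [_ ->] := rc (v^-1 h)%g.
  by case: (h =P h') => [->|_]; rewrite ?mulr0 // !mulr1 (mulrC (r _ y)).
- rewrite -[LHS]/(\sum_l kmap w v r X (1%g, l)) -[RHS]/(\sum_l X (1%g, l)).
  rewrite (reindex_inj (@perm_inj _ v)); apply: eq_bigr => l _.
  by rewrite kmapE permK morph1g // (rc l).1 mul1r.
- apply/ffunP=> -[x h].
  rewrite kmapE -[antipode X]/(drinfeld_antipode X).
  rewrite -[antipode (kmap _ _ _ _)]/(drinfeld_antipode (kmap w v r X)).
  rewrite /drinfeld_antipode !ffunE /= kmapE (morphVg _ vM) rV.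
  rewrite (characterJ _ _ (rc _)) characterV // invrK.
  have -> : (w^-1 (x^-1 ^ h) = (w^-1 x)^-1 ^ (v^-1 h))%g.
    by rewrite -(morphVg _ wM) -J permKV.
  by [].
Qed.

Definition kcomp w v r v' r' h : dualG := r (v' h) * [ffun x => r' h (w^-1%g x)].

Lemma kmap_comp w v r w' v' r' :
  (kmap w v r \o kmap w' v' r')%VF = kmap (w' * w) (v' * v) (kcomp w v r v' r').
Proof.
apply/lfunP=> X; apply/ffunP=> -[x h].
rewrite comp_lfunE !kmapE !invMg !permM mulrA /kcomp fun_mulE ffunE.
by rewrite permKV.
Qed.

Lemma hom_charP r : (forall h, is_character (r h)) ->
  (forall h h' x, r (h * h')%g x = r h x * r h' x) -> is_hom_to_characters r.
Proof. by move=> rc rM; split=> // h h'; apply/ffunP=> x; rewrite fun_mulE rM. Qed.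

Lemma kdata_comp w v r w' v' r' : kdata w v r -> kdata w' v' r' ->
  kdata (w' * w) (v' * v) (kcomp w v r v' r').
Proof.
move=> [wA vA c [rc rM]] [wA' vA' c' [rc' rM']]; split=> [||g|]; [exact: groupM | exact: groupM | | ].
  rewrite invMg !permM -(mulgKV (v' g) (w^-1 _)%g).
  rewrite (AutG_M (groupVr wA')) -mulgA groupM //.
  by apply: AutG_center; rewrite ?groupV.
apply: hom_charP => [h|h h' x]; last first.
  rewrite /kcomp !fun_mulE !ffunE (AutG_M vA') rM rM' !fun_mulE; ring.
rewrite /kcomp; apply: characterMul => //.
have [r1 rm] := rc' h; split=> [|x y]; rewrite !ffunE.
  by rewrite morph1g //; exact/AutG_M/groupVr.
by rewrite (AutG_M (groupVr wA)) rm.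
Qed.

Definition kinv w v r h : dualG := [ffun x => (r (v^-1 h)%g (w x))^-1].

Lemma kdata_inv w v r : kdata w v r -> kdata w^-1 v^-1 (kinv w v r).
Proof.
move=> [wA vA c rH]; split=> [||g|]; rewrite ?groupV //.
  rewrite invgK; have := AutG_center wA (groupVr (c (v^-1 g)%g)).
  rewrite permKV invMg invgK (AutG_M wA) (morphVg _ (AutG_M wA)) permKV.
  by [].
have [rc rM] := rH; apply: hom_charP => [h|h h' x].
  have [r1 rm] := rc (v^-1 h)%g.
  split=> [|x y]; rewrite !ffunE ?(morph1g (AutG_M wA)) ?r1 ?invr1 //.
  by rewrite (AutG_M wA) rm invfM.
by rewrite !ffunE (AutG_M (groupVr vA)) rM fun_mulE invfM.
Qed.

Definition r_one : gT -> dualG := fun=> 1.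

Lemma kdata_one : kdata 1 1 r_one.
Proof.
split=> [||g|]; rewrite ?group1 //; first by rewrite invg1 !perm1 mulgV group1.
by apply: hom_charP => [h|h h' x]; [exact: character1 | rewrite fun_1E mulr1].
Qed.

Lemma eq_kmap w v r r' : r =1 r' -> kmap w v r = kmap w v r'.
Proof. by move=> E; apply/lfunP=> X; apply/ffunP=> -[x h]; rewrite !kmapE E. Qed.

Lemma kmap_one : kmap 1 1 r_one = \1%VF.
Proof.
apply/lfunP=> X; apply/ffunP=> -[x h].
by rewrite kmapE invg1 !perm1 fun_1E mul1r id_lfunE.
Qed.

Lemma kmap_inv w v r : kdata w v r ->
  (kmap w v r \o kmap w^-1 v^-1 (kinv w v r) = \1)%VF /\
  (kmap w^-1 v^-1 (kinv w v r) \o kmap w v r = \1)%VF.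
Proof.
move=> [_ _ _ [rc _]].
rewrite !kmap_comp !mulVg !mulgV -kmap_one; split; apply: eq_kmap => h; apply/ffunP=> x.
  by rewrite /kcomp fun_mulE !ffunE permKV divff ?character_neq0.
by rewrite /kcomp fun_mulE !ffunE permK invgK mulVf ?character_neq0.
Qed.

Lemma kmap_aut w v r : kdata w v r -> AutD (kmap w v r).
Proof.
move=> kd; split; first exact: kmap_hopf.
have [E1 E2] := kmap_inv kd.
exists (kmap w^-1 v^-1 (kinv w v r)) => X; rewrite -[LHS]comp_lfunE ?E1 ?E2.
  by rewrite id_lfunE.
by rewrite id_lfunE.
Qed.

End KMaps.

(** * Automorphisms with trivial r and identical u and v *)

Section LambdaMaps.
Variables (k : fieldType) (gT : finGroupType).
Notation D := (drinfeld k gT).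
Implicit Types (X Y : D) (c d g h x y z : gT) (u : gT * gT).

Lemma injective_hopf_aut (psi : 'End(D)) :
  hopf_morphism psi -> injective psi -> AutD psi.
Proof.
move=> psiH psiI; split=> //; have k0 : lker psi == 0%VS.
  by apply/lker0P.
by exists (psi^-1)%VF => X; [rewrite lker0_lfunK | rewrite lker0_lfunVK].
Qed.

(* a # g |-> a_1 # p(a_2) g, where p(e_c) = sum_h P c h h. *)
Definition lam_fun (P : gT -> gT -> k) X : D :=
  [ffun p => \sum_u P u.1 u.2 * X (u.1 * p.1, u.2^-1 * p.2)%g].

Lemma lam_funE P X g h : lam_fun P X (g, h) =
  \sum_u P u.1 u.2 * X (u.1 * g, u.2^-1 * h)%g.
Proof. by rewrite ffunE. Qed.

Fact lam_fun_linear P : linear (lam_fun P).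
Proof.
move=> a X Y; apply/ffunP=> -[g h]; rewrite !ffunE /= scaler_sumr -big_split.
apply: eq_bigr => u _; rewrite !ffunE mulrDr; congr (_ + _); exact: mulrCA.
Qed.

HB.instance Definition _ P :=
  GRing.isLinear.Build k D D *:%R (lam_fun P) (lam_fun_linear P).

Definition lam P : 'End(D) := linfun (lam_fun P).

Lemma lamE P X g h : lam P X (g, h) =
  \sum_u P u.1 u.2 * X (u.1 * g, u.2^-1 * h)%g.
Proof. by rewrite lfunE lam_funE. Qed.

Variable P : gT -> gT -> k.
Hypothesis PK : central_kernel P.

Lemma kernel_conj c d x : P c d != 0 -> (x ^ c = x)%g /\ (x ^ d = x)%g.
Proof. by case/(kernel_center PK)=> /centerE cc /centerE dc. Qed.

Lemma kernel_commute c d x : P c d != 0 -> commute c x /\ commute d x.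
Proof.
move=> Pcd; have [E E'] := kernel_conj x Pcd.
by split; apply/commute_sym/commgP/conjg_fixP.
Qed.

Lemma lam_1 : lam P 1 = 1.
Proof.
apply/ffunP=> -[g h]; rewrite lamE -[1]/(smash 1 (grp_basis k 1)) smashE fun_1E mul1r.
rewrite grp_basisE sum_pairE exchange_big /=.
transitivity (\sum_d (d == h)%:R * (d == 1%g)%:R : k); last first.
  exact: (sum_dlt h (fun d => (d == 1%g)%:R)).
apply: eq_bigr => d _; rewrite -(kernel_1 PK) mulr_sumr; apply: eq_bigr => c _.
by rewrite smashE fun_1E grp_basisE mul1r mulrC -eq_mulVg1.
Qed.

Lemma lam_M : {morph lam P : X Y / X * Y}.
Proof.
move=> X Y; apply/ffunP=> -[a g]; rewrite lamE mulDE.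
(* The (u, u')-term of [lam P X * lam P Y] after the central elements have been gathered in Y.
   Summing with e = u.2 u'.2 fixed, [kernel_mul] leaves only u'.1 = u.1. *)
pose S u u' : k := P u.1 u.2 * P u'.1 u'.2 *
  \sum_l X (u.1 * a, l)%g * Y (u'.1 * a ^ l, l^-1 * ((u.2 * u'.2)^-1 * g))%g.
transitivity (\sum_u \sum_u' S u u'); last first.
  under [RHS]eq_bigr=> l _ do rewrite !lamE big_distrlr /=.
  rewrite [RHS]exchange_big /=; apply: eq_bigr => u _.
  rewrite [RHS]exchange_big /=; apply: eq_bigr => u' _.
  rewrite /S; have [->|Pu] := eqVneq (P u.1 u.2) 0.
    by rewrite !mul0r big1 // => l _; rewrite !mul0r.
  have [->|Pu'] := eqVneq (P u'.1 u'.2) 0.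
    by rewrite mulr0 mul0r big1 // => l _; rewrite mul0r mulr0.
  rewrite [RHS](reindex_inj (mulgI u.2)) mulr_sumr; apply: eq_bigr => l _ /=.
  have [_ aE] := kernel_conj a Pu; have [_ lE] := kernel_commute l Pu'.
  have -> : (a ^ (u.2 * l) = a ^ l)%g by rewrite conjgM aE.
  have -> : (l^-1 * ((u.2 * u'.2)^-1 * g) = u'.2^-1 * ((u.2 * l)^-1 * g))%g.
    by rewrite !mulgA -!invMg -!mulgA lE.
  rewrite mulKg; ring.
under [RHS]eq_bigr=> u _ do rewrite sum_pairE.
rewrite [RHS]sum_pairE [LHS]sum_pairE; apply: eq_bigr => c _ /=.
under [RHS]eq_bigr=> d _ do rewrite exchange_big (reindex_inj (mulgI d^-1%g)) /=.
rewrite [RHS]exchange_big /=; apply: eq_bigr => e _.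
transitivity (\sum_c' \sum_d P c d * P c' (d^-1 * e)%g *
    \sum_l X (c * a, l)%g * Y (c' * a ^ l, l^-1 * (e^-1 * g))%g); last first.
  rewrite exchange_big; apply: eq_bigr => d _; apply: eq_bigr => c' _.
  by rewrite /S /= mulKVg.
under [RHS]eq_bigr=> c' _ do rewrite -mulr_suml (kernel_mul PK) -mulrA.
rewrite (sum_dlt' c (fun c' => P c e *
  \sum_l X (c * a, l)%g * Y (c' * a ^ l, l^-1 * (e^-1 * g))%g)).
have [->|Pce] := eqVneq (P c e) 0; first by rewrite !mul0r.
rewrite mulDE; congr (_ * _); apply: eq_bigr => l _.
by have [cE _] := kernel_conj l Pce; rewrite conjMg (conjg_fix_sym cE).
Qed.

Lemma lam_comul X : comul (lam P X) = tensor_map (lam P) (comul X).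
Proof.
apply/ffunP=> -[[x h] [y h']].
rewrite (@tensor_map_kernel k gT (gT * gT)%type _ (fun u _ => P u.1 u.2)
  (fun u p => (u.1 * p.1, u.2^-1 * p.2)%g)); last first.
  by move=> X' [x' y']; rewrite lamE.
rewrite comulE lamE /=.
(* Here e is the product of the first coordinates from the two legs; summing over its
   factorizations, [kernel_comul] leaves only d = d'. *)
pose F e d d' : k := X (e * (y * x), d^-1 * h)%g * (d^-1 * h == d'^-1 * h')%g%:R.
transitivity (\sum_d \sum_d' \sum_e \sum_c P c d * P (e * c^-1)%g d' * F e d d').
  rewrite sum_pairE exchange_big mulr_suml; apply: eq_bigr => d _ /=.
  rewrite exchange_big mulr_suml; apply: eq_bigr => e _ /=.
  under eq_bigr=> d' _ do rewrite -mulr_suml (kernel_comul PK) mulrAC.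
  rewrite (sum_dltr' d (fun d' => P e d * F e d d')) /F.
  by rewrite (inj_eq (mulgI _)) mulrA.
rewrite [RHS]sum_pairE [RHS]exchange_big /=; apply: eq_bigr => d _.
under [RHS]eq_bigr=> c _ do rewrite sum_pairE exchange_big /=.
rewrite [RHS]exchange_big /=; apply: eq_bigr => d' _.
rewrite exchange_big; apply: eq_bigr => c _.
rewrite (reindex_inj (mulIg c)); apply: eq_bigr => c' _ /=.
rewrite mulgK comulE /F /=.
have [->|Pcd] := eqVneq (P c d) 0; first by rewrite !mul0r.
by have [cy _] := kernel_commute y Pcd; rewrite -!mulgA (mulgA c) cy !mulgA.
Qed.

Lemma lam_hopf : hopf_morphism (lam P).
Proof.
split; [exact: linearP | exact: lam_1 | exact: lam_M | exact: lam_comul | |] => X.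
  rewrite -[LHS]/(\sum_l lam P X (1%g, l)) -[RHS]/(\sum_l X (1%g, l)).
  under eq_bigr=> l _ do rewrite lamE.
  rewrite exchange_big /= sum_pairE.
  transitivity (\sum_c \sum_d P c d * (\sum_l X (c, l) : k) : k).
    apply: eq_bigr => c _; apply: eq_bigr => d _; rewrite mulr_sumr.
    rewrite (reindex_inj (mulgI d)); apply: eq_bigr => l _.
    by rewrite mulKg mulg1.
  rewrite -[RHS](sum_dlt 1%g (fun c => \sum_l X (c, l))).
  by apply: eq_bigr => c _; rewrite -(kernel_counit PK) mulr_suml.
apply/ffunP=> -[x h].
rewrite lamE -[antipode X]/(drinfeld_antipode X).
rewrite -[antipode (lam _ _)]/(drinfeld_antipode (lam P X)).
rewrite /drinfeld_antipode !ffunE /= lamE.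
rewrite !sum_pairE [RHS](reindex_inj invg_inj); apply: eq_bigr => c _.
rewrite [RHS](reindex_inj invg_inj); apply: eq_bigr => d _ /=.
rewrite (kernel_antipode PK) ffunE /=.
have [->|Pcd] := eqVneq (P c d) 0; first by rewrite !mul0r.
have E y : (y ^ d^-1 = y)%g.
  by have [_ yd] := kernel_conj y Pcd; rewrite -{1}yd conjgK.
have [cE _] := kernel_conj h^-1%g Pcd; have [_ dE] := kernel_commute h Pcd.
have [cC _] := kernel_commute (x^-1 ^ h)%g Pcd.
have ch : (c^-1 ^ h = c^-1)%g.
  by rewrite conjVg; congr _^-1%g; apply: conjg_fix_sym; have [] := kernel_conj h Pcd.
congr (_ * X (_, _)); last first.
  by rewrite invMg !invgK; apply: (mulgI h); rewrite mulKVg mulgA -dE mulgK.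
rewrite conjgM E invMg conjMg ch.
by apply: (mulgI c); rewrite mulKVg mulgA cC mulgK.
Qed.

(** The inverse comes from the convolution inverse of p, namely p followed by the antipode of kG. In
    finite dimension a left inverse is enough. *)
Lemma lam_aut : AutD (lam P).
Proof.
apply: injective_hopf_aut lam_hopf _.
apply: (can_inj (g := lam (fun c d => P c d^-1%g))) => X; apply/ffunP=> -[g h].
rewrite lamE; under eq_bigr=> u _ do rewrite lamE sum_pairE.
rewrite sum_pairE exchange_big /=.
transitivity (\sum_d \sum_d' \sum_e \sum_c
    P c d^-1%g * P (e * c^-1)%g d' * X (e * g, d'^-1 * (d^-1 * h))%g).
  apply: eq_bigr => d _; under eq_bigr=> c _ do rewrite exchange_big mulr_sumr.
  rewrite exchange_big; apply: eq_bigr => d' _.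
  rewrite [RHS]exchange_big; apply: eq_bigr => c _.
  rewrite mulr_sumr [RHS](reindex_inj (mulIg c)); apply: eq_bigr => c' _ /=.
  by rewrite mulgK mulrA !mulgA.
transitivity (\sum_d \sum_e P e d^-1%g * X (e * g, h)%g).
  apply: eq_bigr => d _; rewrite exchange_big; apply: eq_bigr => e _.
  transitivity (\sum_d' (d^-1 == d')%g%:R *
      (P e d^-1%g * X (e * g, d'^-1 * (d^-1 * h))%g)); last first.
    rewrite (sum_dlt' d^-1%g
      (fun d' => P e d^-1%g * X (e * g, d'^-1 * (d^-1 * h))%g)).
    by rewrite mulKg.
  apply: eq_bigr => d' _; rewrite -mulr_suml (kernel_comul PK); ring.
rewrite exchange_big -[in RHS](mul1g g) -(sum_dlt 1%g (fun e => X (e * g, h)%g)).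
apply: eq_bigr => e _; rewrite -mulr_suml -(kernel_counit PK); congr (_ * _).
by rewrite [RHS](reindex_inj invg_inj).
Qed.

End LambdaMaps.

(** * The subgroups *)

Section Subgroups.
Variables (k : fieldType) (gT : finGroupType).
Notation D := (drinfeld k gT).
Notation kG := (grp_alg k gT).
Notation dualG := (fun_alg k gT).
Notation "''Z'" := 'Z([set: gT])%g.
Notation AutG := (Aut [set: gT])%g.
Implicit Types (X Y : D) (a : dualG) (c g h x y z : gT) (w v : {perm gT})
  (r s : gT -> dualG) (psi : 'End(D)).

Definition pull (f : gT -> gT) a : dualG := [ffun x => a (f x)].

Lemma pullE f a x : pull f a x = a (f x). Proof. by rewrite ffunE. Qed.

Lemma pull_character (f : gT -> gT) a : {morph f : x y / (x * y)%g} ->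
  is_character a -> is_character (pull f a).
Proof. by move=> fM [a1 aM]; split=> [|x y]; rewrite !pullE ?morph1g // fM aM. Qed.

Lemma pull_hom (f : gT -> gT) r : {morph f : x y / (x * y)%g} ->
  is_hom_to_characters r -> is_hom_to_characters (fun h => pull f (r h)).
Proof.
move=> fM [rc rM]; apply: hom_charP => [h|h h' x]; first exact: pull_character.
by rewrite !pullE rM fun_mulE.
Qed.

Lemma inv_hom r : is_hom_to_characters r -> is_hom_to_characters (fun h => r h^-1%g).
Proof.
move=> [rc rM]; apply: hom_charP => [//|h h' x].
by rewrite invMg rM fun_mulE mulrC.
Qed.

Lemma pull_fun_basis (w : {perm gT}) g :
  pull w^-1%g (fun_basis k g) = fun_basis k (w g).
Proof.
by apply/ffunP=> x; rewrite pullE !fun_basisE (can2_eq (permKV w) (permK w)).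
Qed.

Lemma id_counit_fixed (psi : D -> D) : hopf_morphism psi ->
  (forall a, id_counit (psi (smash a (grp_basis k 1))) = a) ->
  (forall h, rpart psi h = 1) -> forall X, id_counit (psi X) = id_counit X.
Proof.
move=> psiH u1 r1 X; apply/ffunP=> g; rewrite (id_counit_morphism psiH) id_counitE.
rewrite -[RHS](sum_dlt' g (fun x => \sum_h X (x, h))).
apply: eq_bigr => x _; rewrite mulr_sumr; apply: eq_bigr => h _.
by rewrite r1 fun_1E mulr1 mulrC /ucoef -id_counitE u1 fun_basisE.
Qed.

(** The conditions defining [Lambda] only test a # 1 and 1 # h and are not visibly stable under
    composition. Preservation of [id_counit] on all of D is. *)
Lemma LambdaP psi : Lambda psi <-> [/\ AutD psi,
  forall X, id_counit (psi X) = id_counit X &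
  forall h, psi (smash 1 (grp_basis k h)) = smash 1 (grp_basis k h)].
Proof.
split=> [[aut u1 v1 r1]|[aut u1 j1]]; last first.
  split=> // [a|g|g]; first by rewrite /comp_u u1 id_counit_smash.
    by rewrite /comp_v j1 ev1_id_smash fun_1E scale1r.
  by rewrite /r_trivial /comp_r j1 id_counit_smash.
have psiH := aut.1; split=> // [|h]; first exact: id_counit_fixed.
have [rc E] := gimgP psiH h; rewrite -[LHS]/(gimg psi h) E.
have -> : rpart psi h = 1 by exact: r1.
congr (smash _ _); have := v1 h; rewrite /comp_v -/(gimg psi h) E ev1_id_smash.
by rewrite rc.1 scale1r.
Qed.

Lemma Lambda_group : end_group (@Lambda k gT).
Proof.
split=> [|f g /LambdaP[fA fu fj] /LambdaP[gA gu gj]|f /LambdaP[fA fu fj]].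
- apply/LambdaP; split=> [|X|h]; rewrite ?id_lfunE //; exact: hopf_aut_id.
- apply/LambdaP; split=> [|X|h]; first exact: hopf_aut_comp.
    by rewrite comp_lfunE fu gu.
  by rewrite comp_lfunE gj fj.
have [g [gA fK gK E E']] := hopf_aut_inv fA.
exists g; split=> //; apply/LambdaP; split=> [//|X|h]; first by rewrite -fu gK.
by rewrite -{1}fj fK.
Qed.

Lemma AutD_group : end_group (@AutD k gT).
Proof.
split=> [|f g|f fA]; [exact: hopf_aut_id | exact: hopf_aut_comp |].
by have [g [gA _ _ E E']] := hopf_aut_inv fA; exists g.
Qed.

Lemma finj_comp (T : finType) (f g : T -> T) : injective (f \o g) -> injective f.
Proof.
move=> fgI; have [h gK hK] := injF_bij (inj_compr fgI).
by move=> x y; rewrite -(hK x) -(hK y) => /fgI ->.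
Qed.

(** By [wpartJ], w carries conjugation by v(g) to conjugation by g; since w is onto, w(z v(g)) and g
    induce the same inner automorphism. The factor z leaves room for the twist in [vtwist]. *)
Lemma wpart_center (psi phi : D -> D) z g :
  hopf_morphism psi -> hopf_morphism phi -> cancel psi phi -> cancel phi psi ->
  injective (wpart psi) -> z \in 'Z ->
  (wpart psi (z * vpart psi g) * g^-1)%g \in 'Z.
Proof.
move=> psiH phiH psiK phiK wI /centerE zc; apply/centerE => x.
have [w' _ wK] := injF_bij wI; have wM := wpartM psiH phiH psiK phiK.
rewrite conjgM -(wK x) -(morphJg _ _ wM) conjgM zc.
by rewrite (wpartJ psiH phiH psiK phiK) conjgK.
Qed.

Lemma KP psi : AutD_p_trivial psi <-> exists w v r, kdata w v r /\ psi = kmap w v r.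
Proof.
split=> [[aut pt]|[w [v [r [kd ->]]]]]; last first.
  split=> [|a]; first exact: kmap_aut.
  have [wA vA _ rH] := kd; have [r1 _ _] := hom_charJ rH.
  rewrite /comp_p -[1]/(grp_basis k 1) kmap_smash ev1_id_smash.
  rewrite fun_mulE ffunE r1 fun_1E mul1r (morph1g (AutG_M vA)).
  by rewrite (morph1g (AutG_M (groupVr wA))).
have psiH := aut.1.
have [phi [phiA psiK phiK _ _]] := hopf_aut_inv aut; have phiH := phiA.1.
have pE c h : pcoef psi c h = (c == 1%g)%:R * (h == 1%g)%:R.
  have -> : pcoef psi c h = comp_p psi (fun_basis k c) h by rewrite ev1_idE.
  by rewrite pt !ffunE (eq_sym c).
have fE c : fimg psi c = smash (pull (wpart psi) (fun_basis k c)) (grp_basis k 1).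
  apply/ffunP=> -[x h]; rewrite (fimgE psiH phiH psiK phiK) pE smashE pullE.
  by rewrite fun_basisE grp_basisE -eq_mulVg1.
(* If w missed c, then psi would kill e_c # 1. *)
have wI : injective (wpart psi).
  have wM := wpartM psiH phiH psiK phiK.
  suffices sw : forall c, c \in codom (wpart psi).
    by apply/injectiveP/card_uniqP; rewrite size_map -cardT; apply: eq_card => c; rewrite sw.
  move=> c; apply: contraT => cw; have : fimg psi c = 0.
    rewrite fE; apply/ffunP=> -[x h]; rewrite smashE pullE fun_basisE !ffunE.
    have /negPf-> : wpart psi x != c by apply: contraNneq cw => <-; exact: codom_f.
    by rewrite mul0r.
  have psi0 : psi 0 = 0 by rewrite linear0.
  rewrite /fimg -psi0 => /(can_inj psiK)/ffunP/(_ (c, 1%g)).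
  by rewrite smashE fun_basisE grp_basisE !eqxx !ffunE mulr1 => /eqP; rewrite oner_eq0.
have [rH vM] := gimg_hom psiH.
have z1 chi : is_character chi -> zpart psi chi = 1%g.
  move=> cc; rewrite /zpart.
  have -> : psi (smash chi (grp_basis k 1)) = smash (pull (wpart psi) chi) (grp_basis k 1).
    apply/ffunP=> p; rewrite (fimg_sum psiH); under eq_bigr=> c _ do rewrite fE.
    case: p => x h; rewrite smashE pullE -[RHS](sum_dltr' (wpart psi x) (fun c => chi c * _)).
    by apply: eq_bigr => c _; rewrite smashE pullE fun_basisE; ring.
  by rewrite group_part_smash // pullE (morph1g (wpartM psiH phiH psiK phiK)); case: cc.
(* With p trivial, [gimg_inverse] reduces to v(v'(g)) = g. *)
have vI : injective (vpart psi).
  apply: (@finj_comp _ _ (vpart phi)); apply: (can_inj (g := id)) => g /=.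
  have [E _] := gimg_inverse psiH phiH phiK g.
  by rewrite -[RHS]E z1 ?mul1g //; exact: (gimgP phiH g).1.
(* Since u(f) = f o w sends e_g to e_(w^-1 g), the parameter of [kmap] is the inverse of w. *)
have wA := AutG_perm wI (wpartM psiH phiH psiK phiK).
exists (perm wI)^-1%g, (perm vI), (rpart psi); split.
  split; [by rewrite groupV | exact: AutG_perm | move=> g | by []].
  rewrite invgK !permE -(mul1g (vpart psi g)).
  exact: (wpart_center _ psiH phiH psiK phiK wI (group1 _)).
apply: lfun_basis_ext => g h.
rewrite (psi_smash_grp psiH) -/(fimg psi g) fE smash_char_mul ?mul1g; last exact: rH.1.
rewrite kmap_smash permE; congr smash; apply/ffunP=> x.
by rewrite !fun_mulE !ffunE invgK permE mulrC.
Qed.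

Lemma kmap_group : end_group (@AutD_p_trivial k gT).
Proof.
split=> [|f g /KP[w [v [r [kd ->]]]] /KP[w' [v' [r' [kd' ->]]]]|f /KP[w [v [r [kd ->]]]]].
- by apply/KP; exists 1%g, 1%g, (@r_one k gT); rewrite kmap_one; split=> //; exact: kdata_one.
- apply/KP; rewrite kmap_comp; do 3 eexists; split=> //; exact: kdata_comp.
have [E E'] := kmap_inv kd; exists (kmap w^-1 v^-1 (kinv w v r)); split=> //.
by apply/KP; do 3 eexists; split=> //; exact: kdata_inv.
Qed.

Lemma kmap_basis w v r g h :
  kmap w v r (smash (fun_basis k g) (grp_basis k h)) =
  smash (r h * fun_basis k (w g)) (grp_basis k (v h)).
Proof. by rewrite kmap_smash -/(pull _ _) pull_fun_basis. Qed.

Lemma SpAutcP psi : SpAutc psi <->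
  exists w v, kdata w v (@r_one k gT) /\ psi = kmap w v (@r_one k gT).
Proof.
have [_ _ _ r1] := kdata_one k gT.
split=> [[w [v [wA vA c E]]]|[w [v [[wA vA c _] ->]]]].
  exists w, v; split=> //; apply: lfun_basis_ext => g h.
  by rewrite E kmap_basis mul1r.
by exists w, v; split=> // g h; rewrite kmap_basis mul1r.
Qed.

Lemma HomGGhatP psi : HomGGhat psi <->
  exists r, kdata 1 1 r /\ psi = kmap 1 1 r.
Proof.
split=> [[r rH E]|[r [[_ _ _ rH] ->]]].
  exists r; split; first by have [? ? ? _] := kdata_one k gT.
  by apply: lfun_basis_ext => g h; rewrite E kmap_basis !perm1.
by exists r => // g h; rewrite kmap_basis !perm1.
Qed.

Lemma SpAutc_group : end_group (@SpAutc k gT).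
Proof.
have one w v v' : kcomp w v (@r_one k gT) v' (@r_one k gT) =1 @r_one k gT.
  by move=> h; apply/ffunP=> x; rewrite /kcomp /r_one !ffunE mulr1.
have inv w v : kinv w v (@r_one k gT) =1 @r_one k gT.
  by move=> h; apply/ffunP=> x; rewrite /kinv /r_one !ffunE invr1.
have kd1 w v r : r =1 @r_one k gT -> kdata w v r -> kdata w v (@r_one k gT).
  by move=> _ [? ? ? _]; split=> //; case: (kdata_one k gT).
split=> [|f g /SpAutcP[w [v [kd ->]]] /SpAutcP[w' [v' [kd' ->]]]|f /SpAutcP[w [v [kd ->]]]].
- by apply/SpAutcP; exists 1%g, 1%g; rewrite kmap_one; split=> //; exact: kdata_one.
- apply/SpAutcP; rewrite kmap_comp (eq_kmap _ _ (one w v v')).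
  by do 2 eexists; split=> //; apply: kd1 (one w v v') (kdata_comp kd kd').
have [E E'] := kmap_inv kd; exists (kmap w^-1 v^-1 (kinv w v (@r_one k gT))); split=> //.
apply/SpAutcP; rewrite (eq_kmap _ _ (inv w v)); do 2 eexists; split=> //.
exact: kd1 (inv w v) (kdata_inv kd).
Qed.

Lemma HomGGhat_group : end_group (@HomGGhat k gT).
Proof.
split=> [|f g /HomGGhatP[r [kd ->]] /HomGGhatP[r' [kd' ->]]|f /HomGGhatP[r [kd ->]]].
- apply/HomGGhatP; exists (@r_one k gT); rewrite kmap_one; split=> //; exact: kdata_one.
- apply/HomGGhatP; rewrite kmap_comp; have := kdata_comp kd kd'; rewrite !mulg1 => kd2.
  by eexists; split; first exact: kd2.
have [E E'] := kmap_inv kd; exists (kmap 1^-1 1^-1 (kinv 1 1 r)); split=> //.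
have := kdata_inv kd; rewrite !invg1 => kd2.
by apply/HomGGhatP; eexists; split; first exact: kd2.
Qed.

Lemma lfun_inv_unique (f g : 'End(D)) : (g \o f = \1)%VF -> (f \o g = \1)%VF ->
  (f^-1)%VF = g.
Proof.
move=> gf fg; have f0 : lker f == 0%VS.
  apply/lker0P; apply: (can_inj (g := g)) => X.
  by rewrite -comp_lfunE gf id_lfunE.
apply/lfunP=> X; have {1}-> : X = f (g X) by rewrite -comp_lfunE fg id_lfunE.
exact: lker0_lfunK.
Qed.

Lemma K_semidirect : internal_semidirect (@AutD_p_trivial k gT)
  (@SpAutc k gT) (@HomGGhat k gT).
Proof.
split; last first.
  move=> f n /KP[w [v [r [kd ->]]]] /HomGGhatP[s [kd' ->]].
  have [E E'] := kmap_inv kd; rewrite (lfun_inv_unique E' E) !kmap_comp.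
  have := kdata_comp (kdata_comp kd kd') (kdata_inv kd).
  rewrite !mul1g !mulVg => kd2.
  by apply/HomGGhatP; eexists; split; first exact: kd2.
split; [exact: kmap_group | exact: SpAutc_group | exact: HomGGhat_group | |].
- move=> f; split=> [/KP[w [v [r [kd ->]]]]|[g [h [/SpAutcP[w [v [kd ->]]] /HomGGhatP[r [kd' ->]] ->]]]].
    have [wA vA c rH] := kd; have [? ? ? r1] := kdata_one k gT.
    have sH := pull_hom (AutG_M wA) rH.
    (* Moving the character twist to the right of w pulls the characters back along w. *)
    exists (kmap w v (@r_one k gT)), (kmap 1 1 (fun h => pull w (r h))); split.
    + by apply/SpAutcP; exists w, v.
    + by apply/HomGGhatP; eexists; split=> //; split.
    rewrite kmap_comp !mul1g; apply: eq_kmap => h; apply/ffunP=> x.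
    by rewrite /kcomp /r_one fun_mulE fun_1E mul1r ffunE pullE permKV.
  by apply/KP; rewrite kmap_comp; do 3 eexists; split=> //; exact: kdata_comp.
move=> f /SpAutcP[w [v [kd ->]]] /HomGGhatP[r [_ E]].
(* The coefficient at (w g, v h) is 1 for the first map, while for the second it vanishes unless w g
   = g and v h = h. *)
have E2 g h : w g = g /\ v h = h.
  have := congr1 (fun F : 'End(D) => F (smash (fun_basis k g) (grp_basis k h)) (w g, v h)) E.
  rewrite !kmap_basis !smashE !fun_mulE !fun_basisE ?grp_basisE !perm1 /r_one ?fun_1E !eqxx !mulr1.
  case: eqP => [->|_]; last by rewrite !(mulr0, mul0r) => /eqP; rewrite oner_eq0.
  case: eqP => [->|_] //; by rewrite mulr0 => /eqP; rewrite oner_eq0.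
apply: lfun_basis_ext => g h; rewrite kmap_basis mul1r id_lfunE.
by have [-> ->] := E2 g h.
Qed.

Lemma Lambda_K_trivial psi : Lambda psi -> AutD_p_trivial psi -> psi = \1%VF.
Proof.
move=> /LambdaP[psiA u1 j1] /KP[w [v [r [kd E]]]]; have [_ _ _ rH] := kd.
have [r1 _ _] := hom_charJ rH.
apply: lfun_basis_ext => g h; rewrite id_lfunE -smash_fun_grp (hopf_M psiA.1) j1.
congr (_ * _); have := u1 (smash (fun_basis k g) (grp_basis k 1)).
rewrite E !kmap_basis !id_counit_smash r1 => ->.
by have [_ vA _ _] := kd; rewrite (morph1g (AutG_M vA)).
Qed.

End Subgroups.

(** * The decomposition *)

Section Decomposition.
Variables (k : fieldType) (gT : finGroupType).
Notation D := (drinfeld k gT).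
Notation kG := (grp_alg k gT).
Notation dualG := (fun_alg k gT).
Notation "''Z'" := 'Z([set: gT])%g.
Implicit Types (X Y : D) (a : dualG) (c g h x y z : gT) (r s : gT -> dualG).

Lemma pull_hopf_aut (w : gT -> gT) : injective w -> {morph w : x y / (x * y)%g} ->
  hopf_aut (pull (k := k) w : dualG -> dualG).
Proof.
move=> wI wM; have [w' wK w'K] := injF_bij wI; split; last first.
  by exists (pull w') => a; apply/ffunP=> x; rewrite !pullE ?wK ?w'K.
split=> [b a a'||a a'|a|a|a].
- by apply/ffunP=> x; rewrite !ffunE.
- by apply/ffunP=> x; rewrite !ffunE.
- by apply/ffunP=> x; rewrite !ffunE.
- apply/ffunP=> -[x y]; rewrite tensor_mapE -[comul _]/(fun_comul (pull w a)) ffunE /=.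
  rewrite pullE wM -(sum_dlt' (w x) (fun c => a (c * w y)%g)); apply: eq_bigr => c _.
  rewrite -(sum_dlt' (w y) (fun d => a (c * d)%g)) mulr_sumr; apply: eq_bigr => d _.
  rewrite -[comul a]/(fun_comul a) ffunE /=.
  rewrite -[hcoord _ x]/(pull w (fun_basis k c) x) -[hcoord _ y]/(pull w (fun_basis k d) y).
  by rewrite !pullE !fun_basisE; ring.
- by rewrite -[LHS]/(pull w a 1%g) pullE morph1g.
- by apply/ffunP=> x; rewrite -[antipode a]/(fun_antipode a)
    -[antipode (pull w a)]/(fun_antipode (pull w a)) !ffunE morphVg.
Qed.

Section Automorphism.
Variables psi phi : 'End(D).
Hypotheses (psiA : AutD psi) (phiH : hopf_morphism phi).
Hypotheses (psiK : cancel psi phi) (phiK : cancel phi psi).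
Let psiH : hopf_morphism psi := psiA.1.
Let wM := wpartM psiH phiH psiK phiK.
Let rH : is_hom_to_characters (rpart psi) := (gimg_hom psiH).1.

Lemma comp_uE a : comp_u psi a = pull (wpart psi) a.
Proof.
apply/ffunP=> x; rewrite pullE /comp_u.
exact: (id_counit_img psiH phiH psiK phiK).
Qed.

Lemma comp_vE h : comp_v psi h = grp_basis k (vpart psi h).
Proof.
have [rc E] := gimgP psiH h.
by rewrite /comp_v -/(gimg psi h) E ev1_id_smash rc.1 scale1r.
Qed.

Lemma central_endos : purely_nonabelian gT ->
  injective (vpart psi) /\ injective (wpart psi).
Proof.
move=> pnG; split.
  apply: (@finj_comp _ _ (vpart phi)); apply: (central_endo_inj pnG) => [x y|x] /=.
    by rewrite (gimg_hom phiH).2 (gimg_hom psiH).2.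
  have [E _] := gimg_inverse psiH phiH phiK x.
  have [_ _ zc] := char_img psiH phiK (gimgP phiH x).1.
  set u := vpart psi _; have -> : (u^-1 * x = zpart psi (rpart phi x) ^ u)%g.
    by rewrite -{1}E.
  by move/centerE: (zc) => /(_ u)/conjg_fix_sym->.
apply: (@finj_comp _ _ (wpart phi)); apply: (central_endo_inj pnG) => [x y|x] /=.
  by rewrite (wpartM phiH psiH phiK psiK) wM.
exact: (wpart_inverse psiH phiH psiK phiK).
Qed.

Lemma wpart_inj_of_surj : (forall a, exists b, comp_u psi b = a) ->
  injective (wpart psi).
Proof.
move=> us x y wxy; have [b /ffunP E] := us (fun_basis k x).
have : fun_basis k x x = fun_basis k x y by rewrite -!E comp_uE !pullE wxy.
rewrite !fun_basisE eqxx (eq_sym y); case: eqP => // _ /eqP.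
by rewrite oner_eq0.
Qed.

(** [fimg_pr] recombines u(a_1) # p(a_2) into psi(a # 1), so the map is a # g -> psi(a # 1)(r(g) #
    v(g)), where r enters the right factor only. *)
Lemma of_componentsE r (rc : forall h, is_character (r h)) X :
  of_components (comp_p psi) (comp_u psi) r (comp_v psi) X =
  \sum_(t : gT * gT) X t *: (fimg psi t.1 * smash (r t.2) (grp_basis k (vpart psi t.2))).
Proof.
apply: eq_bigr => -[c h] _ /=; congr (_ *: _); apply/ffunP=> -[x y].
rewrite sum_ffunE mul_smash_grp (characterJ _ _ (rc h)) (fimg_pr psiH) mulr_suml.
rewrite sum_pairE; apply: eq_bigr => z _ /=.
rewrite -(sum_dlt (c * z^-1)%g (fun l => ucoef psi z x * pcoef psi l (y * (vpart psi h)^-1)%g * r h x)).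
apply: eq_bigr => l _; rewrite ffunE smashE fun_mulE comp_vE.
rewrite -[comul _]/(fun_comul (fun_basis k c)) ffunE /= fun_basisE.
have -> : comp_u psi (fun_basis k z) x = ucoef psi z x by rewrite /ucoef -id_counitE.
have -> : (comp_p psi (fun_basis k l) * grp_basis k (vpart psi h) : kG) y =
    pcoef psi l (y * (vpart psi h)^-1)%g.
  rewrite -[_ * _]/(grp_mul _ _) ffunE.
  rewrite -(sum_dltr (y * (vpart psi h)^-1)%g (fun l' => pcoef psi l l')).
  apply: eq_bigr => l' _; rewrite grp_basisE ev1_idE; congr (_ * (nat_of_bool _)%:R).
  by apply/eqP/eqP=> [<-|->]; rewrite ?invMg ?invgK ?mulKVg ?mulgKV.
have -> : (l * z == c)%g = (l == c * z^-1)%g.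
  by apply/eqP/eqP=> [<-|->]; rewrite ?mulgK ?mulgKV.
by rewrite mulrAC.
Qed.

(** When r = 1, id (x) epsilon after the map equals u after id (x) epsilon, so surjectivity passes
    to u. *)
Lemma wpart_inj_of_components r : (forall h, is_character (r h)) ->
  (forall X, exists Y, of_components (comp_p psi) (comp_u psi) r (comp_v psi) Y = X) ->
  (forall h, r h = 1) -> injective (wpart psi).
Proof.
move=> rc surj r1; apply: wpart_inj_of_surj => a.
have [Y /(congr1 (@id_counit k gT))] := surj (smash a (grp_basis k 1)).
rewrite id_counit_smash of_componentsE // => E.
exists [ffun c => \sum_h Y (c, h)]; rewrite -E; apply/ffunP=> x.
rewrite comp_uE pullE ffunE id_counitE.
under [RHS]eq_bigr=> h _ do rewrite sum_ffunE.
rewrite exchange_big sum_pairE -(sum_dltr' (wpart psi x) (fun c => \sum_h Y (c, h))).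
apply: eq_bigr => c _; rewrite mulr_suml; apply: eq_bigr => h _ /=.
under [RHS]eq_bigr=> l _ do rewrite ffunE.
rewrite -[RHS]mulr_sumr; congr (_ * _).
rewrite -id_counitE r1 id_counit_mul_char ?mulr1; last exact: character1.
by rewrite id_counitE eq_sym -(ucoefE psiH phiH psiK phiK).
Qed.

(** * Factoring an automorphism with bijective u *)

Section Bijective.
Hypothesis wI : injective (wpart psi).
Let wp := perm wI.
Let wpA : wp \in Aut [set: gT] := AutG_perm wI wM.
Let wiM : {morph (wp^-1)%g : x y / (x * y)%g} := AutG_M (groupVr wpA).

(* h |-> p(u^-1(r(h))^-1) v(h) *)
Definition vtwist r h : gT :=
  (zpart psi (pull (wp^-1)%g (r h^-1%g)) * vpart psi h)%g.

Lemma wi_wpart x : (wp^-1)%g (wpart psi x) = x.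
Proof. by rewrite -[wpart psi x](permE wI) permK. Qed.

Lemma pull_char r h : is_hom_to_characters r -> is_character (pull (wp^-1)%g (r h)).
Proof. by move=> [rc _]; apply: pull_character. Qed.

Lemma zpart_pullM r g h : is_hom_to_characters r ->
  zpart psi (pull (wp^-1)%g (r (g * h)%g)) =
  (zpart psi (pull (wp^-1)%g (r g)) * zpart psi (pull (wp^-1)%g (r h)))%g.
Proof.
move=> rh; rewrite -(zpartM psiH phiK (pull_char g rh) (pull_char h rh)); congr (zpart _ _).
by apply/ffunP=> x; rewrite fun_mulE !pullE; have [_ rM] := rh; rewrite rM fun_mulE.
Qed.

Lemma zpart_pullZ r h : is_hom_to_characters r ->
  zpart psi (pull (wp^-1)%g (r h)) \in 'Z.
Proof. by move=> rh; have [] := char_img psiH phiK (pull_char h rh). Qed.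

Lemma vtwistM r : is_hom_to_characters r -> {morph vtwist r : g h / (g * h)%g}.
Proof.
move=> rh g h; rewrite /vtwist invMg zpart_pullM // (gimg_hom psiH).2.
set z := zpart _ _; set z' := zpart psi (pull _ (r g^-1%g)).
have zc y : commute z y.
  by have /centerE/(_ y)/conjg_fix_sym/conjg_fixP/commgP := zpart_pullZ h^-1%g rh.
by rewrite -!mulgA [LHS]zc -!mulgA (zc (vpart _ _)).
Qed.

Lemma psi_pull r h : is_hom_to_characters r ->
  psi (smash (pull (wp^-1)%g (r h)) (grp_basis k 1)) =
  smash (r h) (grp_basis k (zpart psi (pull (wp^-1)%g (r h)))).
Proof.
move=> rh; have [_ -> _] := char_img psiH phiK (pull_char h rh).
congr smash; apply/ffunP=> x.
by rewrite (id_counit_img psiH phiH psiK phiK) pullE wi_wpart.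
Qed.

Lemma psi_twist r h : is_hom_to_characters r ->
  psi (smash (pull (wp^-1)%g (r h^-1%g)) (grp_basis k h)) =
  smash (r h^-1%g * rpart psi h) (grp_basis k (vtwist r h)).
Proof.
by move=> rh; rewrite (psi_smash_grp psiH) psi_pull // smash_char_mul //; case: rH.
Qed.

(** The map v' is a right inverse: the second half of [gimg_inverse] identifies r'(g) with
    u^-1(r(v'(g)))^-1, and the first half then says vt(v'(g)) = g. *)
Lemma vtwist_inj : injective (vtwist (rpart psi)).
Proof.
apply: (@finj_comp _ _ (vpart phi)); apply: (can_inj (g := id)) => g /=.
have [E E1] := gimg_inverse psiH phiH phiK g.
rewrite -[RHS]E /vtwist; congr (zpart psi _ * _)%g; apply/ffunP=> x.
have [_ rV _] := hom_charJ rH; rewrite pullE rV.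
have := congr1 (fun a : dualG => a ((wp^-1)%g x)) E1.
rewrite fun_mulE fun_1E (id_counit_img psiH phiH psiK phiK).
have -> : wpart psi ((wp^-1)%g x) = x by rewrite -[LHS](permE wI) permKV.
set u := rpart psi _ _; have u0 : u != 0 by apply: character_neq0; case: rH.
by move=> ux; rewrite -[RHS](mulfK u0) ux mul1r.
Qed.

Definition ktwist r (vI : injective (vtwist r)) : 'End(D) :=
  kmap (wp^-1)%g (perm vI) r.

Lemma kdata_twist r (vI : injective (vtwist r)) : is_hom_to_characters r ->
  kdata (wp^-1)%g (perm vI) r.
Proof.
move=> rh; split; [by rewrite groupV | exact: AutG_perm (vtwistM rh) | move=> g | by []].
rewrite invgK !permE.
exact: (wpart_center _ psiH phiH psiK phiK wI (zpart_pullZ _ rh)).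
Qed.

Lemma ktwist_fun r (vI : injective (vtwist r)) a : is_hom_to_characters r ->
  ktwist vI (smash (pull (wp^-1)%g a) (grp_basis k 1)) = smash a (grp_basis k 1).
Proof.
move=> rh; rewrite kmap_smash permE (morph1g (vtwistM rh)); have [-> _ _] := hom_charJ rh.
by congr smash; apply/ffunP=> x; rewrite mul1r !ffunE permKV.
Qed.

(** Both psi and kappa send u^-1(r(h))^-1 # h to 1 # vt(h). Hence psi kappa^-1 fixes every 1 #
    vt(h), and these are all the 1 # g because vt is a permutation. *)
Lemma Lambda_ktwist : exists lambda, Lambda lambda /\
  psi = (lambda \o ktwist vtwist_inj)%VF.
Proof.
set kap := ktwist _; have kd := kdata_twist vtwist_inj rH.
have [kapi [kapiA kK kiK E E']] := hopf_aut_inv (kmap_aut kd).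
exists (psi \o kapi)%VF; split; last first.
  by rewrite -comp_lfunA -/kap E' comp_lfun1r.
have [rc _] := rH; have [_ rV _] := hom_charJ rH.
have lamE h : (psi \o kapi)%VF (smash 1 (grp_basis k (perm vtwist_inj h))) =
    smash 1 (grp_basis k (perm vtwist_inj h)).
  have E1 : kap (smash (pull (wp^-1)%g (rpart psi h^-1%g)) (grp_basis k h)) =
      smash 1 (grp_basis k (perm vtwist_inj h)).
    rewrite kmap_smash; congr smash; apply/ffunP=> x.
    by rewrite fun_mulE [X in _ * X]ffunE pullE permKV rV divff ?fun_1E // character_neq0.
  rewrite -{1}E1 comp_lfunE kK psi_twist // permE; congr smash.
  by apply/ffunP=> x; rewrite fun_mulE fun_1E rV mulVf // character_neq0.
split=> [|a|g|g]; first exact: hopf_aut_comp.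
- rewrite /comp_u -[1]/(grp_basis k 1) -(ktwist_fun vtwist_inj a rH) comp_lfunE kK.
  by rewrite -/(comp_u psi _) comp_uE; apply/ffunP=> x; rewrite !pullE wi_wpart.
- by rewrite /comp_v -(permKV (perm vtwist_inj) g) lamE ev1_id_smash fun_1E scale1r.
by rewrite /comp_r -(permKV (perm vtwist_inj) g) lamE id_counit_smash.
Qed.

(** The map is lambda composed with the twist for the new r, where lambda is the one obtained from
    psi itself: on a # 1 the twist does not depend on r. *)
Lemma of_components_aut r (vI : injective (vtwist r)) : is_hom_to_characters r ->
  hopf_aut (of_components (comp_p psi) (comp_u psi) r (comp_v psi)).
Proof.
move=> rh; have [lambda [/LambdaP[lamA _ lamj] E]] := Lambda_ktwist.
have ktA : AutD (ktwist vI) := kmap_aut (kdata_twist vI rh).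
apply: (@eq_hopf_aut _ _ (lambda \o ktwist vI)%VF); last first.
  exact: (hopf_aut_comp lamA ktA).
move=> X; rewrite of_componentsE; last by case: rh.
rewrite comp_lfunE {1}(@hcoordK k D X) !linear_sum; apply: eq_bigr => -[c h] _.
rewrite !linearZ /=; congr (_ *: _); rewrite -smash_delta.
rewrite -smash_fun_grp (hopf_M ktA.1) (hopf_M lamA.1).
have lamE a : lambda (smash a (grp_basis k 1)) =
    psi (smash (pull (wp^-1)%g a) (grp_basis k 1)).
  by rewrite E comp_lfunE (ktwist_fun _ _ rH).
congr (_ * _).
  have cE : fun_basis k c = pull (wp^-1)%g (pull wp (fun_basis k c)).
    by apply/ffunP=> x; rewrite !pullE permKV.
  by rewrite {1}cE (ktwist_fun _ _ rh) lamE -cE.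
have -> : ktwist vI (smash 1 (grp_basis k h)) = smash (r h) (grp_basis k (vtwist r h)).
  by rewrite kmap_smash permE; congr smash; apply/ffunP=> x; rewrite !ffunE mulr1.
(* Applied to r(h) # vt(h), lambda contributes the group factor p(u^-1(r(h))), which cancels the
   inverse built into [vtwist] and leaves r(h) # v(h). *)
rewrite -smash_fun_grp (hopf_M lamA.1) lamj lamE psi_pull // smash_char_mul; last exact: character1.
rewrite mulr1 /vtwist mulgA -zpart_pullM // mulgV.
have [-> _ _] := hom_charJ rh; congr (smash _ (grp_basis k _)).
rewrite /zpart; have -> : pull (wp^-1)%g 1 = 1 :> dualG by apply/ffunP=> x; rewrite !ffunE.
by rewrite (hopf_1 psiH) group_part_smash ?mul1g // fun_1E.
Qed.

Lemma vtwist_inj_of_group_aut r : is_hom_to_characters r ->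
  (forall f : 'End(D), AutD f -> is_group_aut (comp_v f)) -> injective (vtwist r).
Proof.
move=> rh vaut; pose s h : dualG := pull (wp^-1)%g (r h^-1%g).
have sh : is_hom_to_characters s by apply: pull_hom wiM _; exact: inv_hom.
have kd : kdata 1 1 s by have [? ? ? _] := kdata_one k gT; split.
have [w0 _ w0E] := vaut (psi \o kmap 1 1 s)%VF (hopf_aut_comp psiA (kmap_aut kd)).
suffices vE : vtwist r =1 w0 by move=> x y; rewrite !vE; exact: perm_inj.
move=> h; have := w0E h; rewrite /comp_v comp_lfunE kmap_smash perm1.
rewrite (_ : s h * _ = s h); last by apply/ffunP=> x; rewrite !ffunE mulr1.
rewrite psi_twist // ev1_id_smash fun_mulE.
have [rc _] := rh; have [rc' _] := rH; rewrite (rc _).1 (rc' _).1 mulr1 scale1r.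
move/ffunP/(_ (vtwist r h)); rewrite !grp_basisE eqxx.
by case: eqP => // _ /eqP; rewrite oner_eq0.
Qed.

End Bijective.
End Automorphism.
End Decomposition.

(** * The equivalence *)

Section NotPurelyNonabelian.
Variables (k : closedFieldType) (gT : finGroupType).
Notation D := (drinfeld k gT).
Notation dualG := (fun_alg k gT).

(** The factor in [Lambda] does not affect [id_counit], and the factor in K acts on a # 1 through an
    automorphism of G. *)
Lemma Lambda_K_id_counit_inj (psi : 'End(D)) :
  (exists f g, [/\ Lambda f, AutD_p_trivial g & psi = (f \o g)%VF]) ->
  injective (fun a : dualG => id_counit (psi (smash a (grp_basis k 1)))).
Proof.
move=> [f [g [/LambdaP[fA fu fj] /KP[w [v [r [kd ->]]]] ->]]] a b.
have [_ _ _ rH] := kd; have [r1 _ _] := hom_charJ rH.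
rewrite !comp_lfunE !fu !kmap_smash !id_counit_smash r1 !mul1r => E.
apply/ffunP=> x; have := congr1 (fun c : dualG => c (w x)) E.
by rewrite !ffunE permK.
Qed.

(* Composing the Fourier map in Lambda with the character twist in K kills
   the character beta x: it is sent to 1 # x. *)
Lemma exists_id_counit_not_inj (x : gT) (H : {group gT}) :
  [pchar k] =i pred0 -> (<[x]> \x H)%g = [set: gT] -> (1 < #[x]%g)%N ->
  exists2 psi : 'End(D), AutD psi &
    ~ injective (fun a : dualG => id_counit (psi (smash a (grp_basis k 1)))).
Proof.
move=> char0 dG x1; have [beta [P [bH PK bx PF]]] := fourier_kernel char0 dG x1.
have [bc bM] := bH; have [_ bV _] := hom_charJ bH.
pose s h := beta h^-1%g; have sH : is_hom_to_characters s by exact: inv_hom.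
have kd : kdata 1 1 s by have [? ? ? _] := kdata_one k gT; split.
exists (kmap 1 1 s \o lam P)%VF; first exact: hopf_aut_comp (kmap_aut kd) (lam_aut PK).
have lamx : lam P (smash (beta x) (grp_basis k 1)) = smash (beta x) (grp_basis k x).
  apply/ffunP=> -[g h]; rewrite lamE smashE grp_basisE -PF sum_pairE mulr_sumr.
  apply: eq_bigr => c _.
  rewrite -(sum_dlt h (fun d => beta x g * (P c d * beta x c))).
  apply: eq_bigr => d _; rewrite smashE grp_basisE -eq_mulVg1 /=.
  by have [_ ->] := bc x; ring.
move=> inj; move/eqP: bx; apply; apply: inj; rewrite !comp_lfunE lamx.
rewrite -[smash 1 _]/(1 : D) lam_1 // -[1 in RHS]/(smash 1 (grp_basis k 1)).
rewrite !kmap_smash !id_counit_smash; have [s1 _ _] := hom_charJ sH; rewrite s1.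
apply/ffunP=> y; rewrite !fun_mulE /s bV ![[ffun _ => _] _]ffunE invg1 perm1.
by rewrite mulVf ?fun_1E ?mulr1 // character_neq0.
Qed.

End NotPurelyNonabelian.

Theorem theorem5p15 (k : closedFieldType) (char0 : [pchar k] =i pred0)
    (gT : finGroupType) :
  [<-> purely_nonabelian gT;
       forall psi : 'End(drinfeld k gT), AutD psi ->
         hopf_aut (comp_u psi) /\ is_group_aut (comp_v psi);
       forall (r' : gT -> fun_alg k gT) (psi : 'End(drinfeld k gT)),
         is_hom_to_characters r' -> AutD psi ->
         hopf_aut (of_components (comp_p psi) (comp_u psi) r' (comp_v psi));
       internal_semidirect (@AutD_p_trivial k gT)
         (@SpAutc k gT) (@HomGGhat k gT) /\
       exact_factorization (@AutD k gT)
         (@Lambda k gT) (@AutD_p_trivial k gT)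
  ].
Proof.
tfae=> [pnG psi psiA|ii r psi rH psiA|iii|[_ [_ _ _ fact _]] A B dAB abA].
- have [phi [[phiH _] psiK phiK _ _]] := hopf_aut_inv psiA.
  have [vI wI] := central_endos psiA phiH psiK phiK pnG; have psiH := psiA.1.
  split.
    apply: eq_hopf_aut (pull_hopf_aut _ wI (wpartM psiH phiH psiK phiK)) => a.
    by rewrite (comp_uE psiA phiH psiK phiK).
  exists (perm vI); first exact: AutG_perm (gimg_hom psiH).2.
  by move=> g; rewrite (comp_vE psiA) permE.
- have [phi [[phiH _] psiK phiK _ _]] := hopf_aut_inv psiA.
  have wI : injective (wpart psi).
    apply: (wpart_inj_of_surj psiA phiH psiK phiK) => a.
    have [[_ [f _ fK]] _] := ii psi psiA; by exists (f a).
  apply: (of_components_aut psiA phiH psiK phiK (wI := wI)) => //.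
  by apply: (vtwist_inj_of_group_aut psiA phiH psiK phiK) => // f /ii[].
- split; first exact: K_semidirect.
  split; [exact: AutD_group | exact: Lambda_group | exact: kmap_group | |].
    move=> psi; split=> [psiA|[f [g [[fA _ _ _] [gA _] ->]]]]; last exact: hopf_aut_comp.
    have [phi [[phiH _] psiK phiK _ _]] := hopf_aut_inv psiA.
    have [_ _ _ r1] := kdata_one k gT.
    have wI : injective (wpart psi).
      apply: (wpart_inj_of_components psiA phiH psiK phiK r1.1 _ (fun=> erefl)) => X.
      by have [_ [f _ fK]] := iii _ psi r1 psiA; exists (f X).
    have [lambda [lamL E]] := Lambda_ktwist psiA phiH psiK phiK wI.
    exists lambda, (ktwist (vtwist_inj psiA phiH psiK phiK (wI := wI))); split=> //.
    apply/KP; do 3 eexists; split=> //; apply: (kdata_twist psiA phiH psiK phiK).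
    exact: (gimg_hom psiA.1).1.
  by move=> psi; exact: Lambda_K_trivial.
apply/eqP; apply: contraT => A1.
have [x [H [x1 dG]]] := abelian_cyclic_factor dAB abA A1.
have [psi psiA []] := exists_id_counit_not_inj char0 dG x1.
exact/Lambda_K_id_counit_inj/fact.
Qed.
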